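(* Let $1\le i\neq j\le \ell$. The operator $\square^{(i,j)}_{n_i-1,n_j-1}$ acting on $u(z;\alpha)\in\mathcal{S}(\alpha)$ induces the operator $\tilde M^{(i,j)}(\alpha)$ acting on the restriction $u(\mathbf{x};\alpha)$ of $u$ to the slice $X$, where $$\tilde M^{(i,j)}(\alpha)=(x_0^{(i)}-x_0^{(j)})D^{(i)}_{n_i-1}D^{(j)}_{n_j-1}+\alpha^{(j)}_{n_j-1}D^{(i)}_{n_i-1}-\alpha^{(i)}_{n_i-1}D^{(j)}_{n_j-1}.$$ In particular (since $\square^{(i,j)}_{n_i-1,n_j-1}u=0$) one has $\tilde M^{(i,j)}(\alpha)\,u(\mathbf{x};\alpha)=0$ for every $u\in\mathcal{S}(\alpha)$.
   Context: $N>2$; $\lambda=(n_1\ge\dots\ge n_\ell>0)$ is a partition of $N$. For $n\ge1$ let $\Lambda=(\delta_{a+1,b})_{0\le a,b<n}$ and $J(n)$ the group of invertible $h=\sum_{0\le k<n}h_k\Lambda^k$; $H_\lambda=\{\mathrm{diag}(h^{(1)},\dots,h^{(\ell)}): h^{(k)}\in J(n_k)\}$. $Z_\lambda$ is the set of complex $2\times N$ matrices $z=(z^{(1)},\dots,z^{(\ell)})$, $z^{(k)}=(z^{(k)}_0,\dots,z^{(k)}_{n_k-1})$, with columns $z^{(k)}_a={}^t(z^{(k)}_{0,a},z^{(k)}_{1,a})$, such that $\det(z^{(k)}_0,z^{(l)}_0)\ne0$ for $k\neq l$ and $\det(z^{(k)}_0,z^{(k)}_1)\neq0$ whenever $n_k\ge2$.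 Put $\partial^{(k)}_{r,a}=\partial/\partial z^{(k)}_{r,a}$ and $\square^{(p,q)}_{a,b}=\partial^{(p)}_{0,a}\partial^{(q)}_{1,b}-\partial^{(p)}_{1,a}\partial^{(q)}_{0,b}$. Define $\theta_k$ by $\log(x_0+x_1T+\cdots)=\sum_{k\ge0}\theta_k(x)T^k$. For $\alpha=(\alpha^{(1)},\dots,\alpha^{(\ell)})\in\mathbb{C}^N$, $\alpha^{(k)}=(\alpha^{(k)}_0,\dots,\alpha^{(k)}_{n_k-1})$, the multivalued character of $H_\lambda$ is $\chi(h;\alpha)=\prod_{k}(h^{(k)}_0)^{\alpha^{(k)}_0}\exp(\sum_{1\le a<n_k}\alpha^{(k)}_a\theta_a(h^{(k)}))$. Standing assumption on $\alpha$: $\alpha^{(k)}_{n_k-1}\ne0$ if $n_k\ge2$, $\alpha^{(k)}_0\notin\mathbb{Z}$ if $n_k=1$, and $\sum_k\alpha^{(k)}_0=-2$. $Sol(\mathcal I)$ is the sheaf of holomorphic functions on $Z_\lambda$ annihilated by all $\square^{(p,q)}_{a,b}$, and $\mathcal S(\alpha)=\{u\in Sol(\mathcal I): u(zh)=u(z)\chi(h;\alpha),\ h\in H_\lambda\}$ (multivalued functions, matching branches). The slice $X\subset Z_\lambda$ is the set of $\mathbf{x}=(\mathbf{x}^{(1)},\dots,\mathbf{x}^{(\ell)})\in Z_\lambda$ with $\mathbf{x}^{(k)}=\begin{pmatrix}x^{(k)}_0&x^{(k)}_1&\cdots&x^{(k)}_{n_k-1}\\1&0&\cdots&0\end{pmatrix}$;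 $D^{(k)}_a=\partial/\partial x^{(k)}_a$. Each $z\in Z_\lambda$ with all $z^{(k)}_{1,0}\ne0$ can be written uniquely as $zh=\mathbf{x}\in X$ with $h\in H_\lambda$, and then $u(z;\alpha)=u(\mathbf{x};\alpha)\chi(h^{-1};\alpha)$. ''An operator $P$ on $Z_\lambda$ induces an operator $\mathcal P$ on $X$'' means: substituting $u(z)=\chi(h^{-1};\alpha)v(\mathbf{x})$ (with $zh=\mathbf{x}$, $v=u|_X$) and computing by the chain rule gives $Pu=\rho(z)\cdot(\mathcal P v)(\mathbf{x})$ with a nowhere vanishing factor $\rho(z)$ independent of $v$ and equal to $1$ on $X$. *)

(* Defs.v *)
(* MathComp-Analysis; complex numbers are R[i]^o for R : realType, i.e.
   R[i] as a normed module over itself, so that 'D_v is a complex derivative *)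
From HB Require Import structures.
From mathcomp Require Import all_boot all_order all_algebra.
From mathcomp Require Import complex finmap.
From mathcomp Require Import all_classical all_reals all_analysis.
From mathcomp.analysis.showcase Require Import summability.

Set Implicit Arguments.
Unset Strict Implicit.
Unset Printing Implicit Defensive.

Import Order.TTheory GRing.Theory Num.Theory numFieldNormedType.Exports.

Local Open Scope classical_set_scope.
Local Open Scope ring_scope.

Section ComplexAnalysis.
Variable R : realType.
Local Notation C := R[i]^o.

Definition cexp (w : R[i]) : R[i] :=
  (expR (complex.Re w))%:C%C *
  (cos (complex.Im w) +i* sin (complex.Im w))%C.

(* Holomorphy at z of a function of the a * b complex variables z_(r, c):
   near z, f is the sum of a power series in z' - z, indexed by multi-indices
   nu.  A multiple series has no preferred order of summation: convergence is
   along the directed set of all finite sets of multi-indices, i.e. it is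
   unconditional (equivalently, absolute). *)
Definition holomorphic_at (a b : nat) (f : 'M[C]_(a, b) -> C)
    (z : 'M[C]_(a, b)) : Prop :=
  exists c : {ffun 'I_a * 'I_b -> nat} -> C,
    \forall z' \near z,
      partial_sum (fun nu : {ffun 'I_a * 'I_b -> nat} =>
        c nu * \prod_(e : 'I_a * 'I_b) ((z' - z) e.1 e.2) ^+ nu e)
      @ totally --> f z'.

(* theta_a for a >= 1, for the series x = x_0 + x_1 T + ... with x_0 <> 0: the
   coefficient of T^a in
     log (x / x_0) = \sum_(j >= 1) (-1)^(j+1) / j * (x / x_0 - 1)^j,
   to which only the terms j <= a contribute.  The multivalued theta_0 = log x_0
   is not covered: its branches are carried by the points of [Hcov]. *)
Definition theta (x : {poly C}) (a : nat) : C :=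
  (\sum_(1 <= j < a.+1)
     ((-1) ^+ j.+1 / j%:R) *: ((x`_0)^-1 *: x - 1) ^+ j)`_a.

End ComplexAnalysis.

(* The partition lambda = (n_0 >= n_1 >= ... ) of N with l positive parts is
   given by m : 'I_l -> nat, with n_k = (m k).+1.  The N columns are split in
   blocks by [tagnat.Rank]: column a of block k is [Rank k a], a : 'I_(m k).+1;
   in particular a = n_k - 1 is [ord_max]. *)
Section Confluent.
Variables (R : realType) (l : nat) (m : 'I_l -> nat).
Local Notation C := R[i]^o.
Local Notation N := (\sum_(k < l) (m k).+1)%N.

Definition ix (k : 'I_l) (a : 'I_(m k).+1) : 'I_N :=
  @tagnat.Rank l (fun k => (m k).+1) k a.

Definition Zlam : set 'M[C]_(2, N) := [set z |
  (forall k k' : 'I_l, k != k' ->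
     \det (row_mx (col (@ix k ord0) z) (col (@ix k' ord0) z) : 'M[C]_2) != 0) /\
  (forall k : 'I_l, (0 < m k)%N ->
     \det (row_mx (col (@ix k ord0) z) (col (@ix k (inord 1)) z) : 'M[C]_2) != 0)].

Definition shift_mx (n : nat) : 'M[C]_n.+1 := \matrix_(a, b) (a.+1 == b)%N%:R.

Definition jordan (n : nat) : set 'M[C]_n.+1 := [set h | h \in unitmx /\
  exists c : 'I_n.+1 -> C, h = \sum_(k < n.+1) c k *: shift_mx n ^+ k].

Definition Hlam : set 'M[C]_N := [set h |
  exists B : forall k : 'I_l, 'M[C]_((m k).+1),
    (forall k, @jordan (m k) (B k)) /\ h = \mxdiag_(k < l) B k].

(* h^(k)_a is the entry (0, a) of the k-th diagonal block of h. *)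
Definition hcoef (h : 'M[C]_N) (k : 'I_l) (a : 'I_(m k).+1) : C :=
  h (@ix k ord0) (ix a).

Definition hpoly (h : 'M[C]_N) (k : 'I_l) : {poly C} :=
  \poly_(a < (m k).+1) @hcoef h k (inord a).

(* The universal covering group of H_lambda: pairs g = (h, w) with h in
   H_lambda and w_k a logarithm of h^(k)_0.  [chi] is the (single-valued)
   character it carries; the values of the multivalued chi(h; alpha) are the
   chi alpha (h, w). *)
Definition Hcov : set ('M[C]_N * 'rV[C]_l) := [set g : 'M[C]_N * 'rV[C]_l |
  Hlam g.1 /\ forall k : 'I_l, cexp (g.2 0 k) = @hcoef g.1 k ord0].

Definition Hone : 'M[C]_N * 'rV[C]_l := (1%:M, 0).
Definition Hmul (g g' : 'M[C]_N * 'rV[C]_l) : 'M[C]_N * 'rV[C]_l :=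
  (g.1 *m g'.1, g.2 + g'.2).
Definition Hinv (g : 'M[C]_N * 'rV[C]_l) : 'M[C]_N * 'rV[C]_l :=
  (invmx g.1, - g.2).

Definition chi (alpha : 'rV[C]_N) (g : 'M[C]_N * 'rV[C]_l) : C :=
  \prod_(k < l)
    (cexp (alpha 0 (@ix k ord0) * g.2 0 k) *
     cexp (\sum_(a < (m k).+1 | (0 < a)%N)
             alpha 0 (@ix k a) * theta (hpoly g.1 k) a)).

Definition admissible (alpha : 'rV[C]_N) : Prop :=
  [/\ forall k : 'I_l, (0 < m k)%N -> alpha 0 (@ix k ord_max) != 0,
      forall k : 'I_l, m k = 0%N ->
        forall c : int, alpha 0 (@ix k ord0) != c%:~R
    & \sum_(k < l) alpha 0 (@ix k ord0) = - 2%:R].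

Definition dZ (r : 'I_2) (k : 'I_l) (a : 'I_(m k).+1)
    (f : 'M[C]_(2, N) -> C) (z : 'M[C]_(2, N)) : C :=
  'D_(delta_mx r (ix a)) f z.

Definition box (p q : 'I_l) (a : 'I_(m p).+1) (b : 'I_(m q).+1)
    (f : 'M[C]_(2, N) -> C) (z : 'M[C]_(2, N)) : C :=
  dZ 0 a (dZ 1 b f) z - dZ 1 a (dZ 0 b f) z.

(* A point of the slice X is x = slice y, where y is its first row; functions on
   X are functions of y. *)
Definition slice (y : 'rV[C]_N) : 'M[C]_(2, N) :=
  \matrix_(r, c) (if r == 0 then y 0 c
                  else (tagnat.sig2 c == 0 :> nat)%:R).

Definition Xlam : set 'M[C]_(2, N) :=
  [set x | Zlam x /\ x = slice (row 0 x)].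

Definition dX (k : 'I_l) (a : 'I_(m k).+1)
    (v : 'rV[C]_N -> C) (y : 'rV[C]_N) : C :=
  'D_(delta_mx 0 (ix a)) v y.

Definition Mtilde (alpha : 'rV[C]_N) (i j : 'I_l)
    (v : 'rV[C]_N -> C) (y : 'rV[C]_N) : C :=
  (y 0 (@ix i ord0) - y 0 (@ix j ord0)) *
      dX (ord_max : 'I_(m i).+1) (dX (ord_max : 'I_(m j).+1) v) y
  + alpha 0 (@ix j ord_max) * dX (ord_max : 'I_(m i).+1) v y
  - alpha 0 (@ix i ord_max) * dX (ord_max : 'I_(m j).+1) v y.

(* P induces Q: substituting u(z) = chi(h^-1) v(x), z h = x in X, gives
   P u = rho * (Q v)(x).  Here v is any holomorphic function on an open subset V
   of X (a branch of a multivalued function on X), and the branch of chi(h^-1)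
   on an open set U of z's is fixed by a continuous z |-> g(z) = (h, w) in
   [Hcov], h being determined by z.  Like chi(h^-1), the factor rho is a
   multivalued function of z, i.e. a function of z and g; on X it is 1 for the
   branch with g = 1. *)
Definition induces (alpha : 'rV[C]_N)
    (P : ('M[C]_(2, N) -> C) -> 'M[C]_(2, N) -> C)
    (Q : ('rV[C]_N -> C) -> 'rV[C]_N -> C) : Prop :=
  exists rho : 'M[C]_(2, N) -> 'M[C]_N * 'rV[C]_l -> C,
  [/\ forall z g, Hcov g -> Xlam (z *m g.1) -> rho z g != 0,
      forall x, Xlam x -> rho x Hone = 1
    & forall (V : set 'rV[C]_N) (v : 'rV[C]_N -> C)
        (U : set 'M[C]_(2, N)) (g : 'M[C]_(2, N) -> 'M[C]_N * 'rV[C]_l),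
      open V -> V `<=` [set y | Zlam (slice y)] ->
      (forall y, V y -> holomorphic_at v y) ->
      open U -> {within U, continuous g} ->
      (forall z, U z -> [/\ Hcov (g z), Xlam (z *m (g z).1)
                          & V (row 0 (z *m (g z).1))]) ->
      forall z, U z ->
        P (fun z' => chi alpha (Hinv (g z')) * v (row 0 (z' *m (g z').1))) z
        = rho z (g z) * Q v (row 0 (z *m (g z).1))].

(* A domain for multivalued functions on Z_lambda: a space W with a local
   homeomorphism proj : W -> Z_lambda (continuous, open, locally injective) to
   which the right action z |-> z h is lifted as an action of [Hcov].  The
   universal covering of Z_lambda is an example; a multivalued function on
   Z_lambda is a function on such a W, and the points of W above z index its
   branches at z. *)
Record mvdomain := MvDomain {
  mv_space :> topologicalType;
  mv_proj : mv_space -> 'M[C]_(2, N);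
  mv_act : mv_space -> 'M[C]_N * 'rV[C]_l -> mv_space;
  _ : forall w, Zlam (mv_proj w);
  _ : continuous mv_proj;
  _ : forall A : set mv_space, open A -> open (mv_proj @` A);
  _ : forall w : mv_space, exists2 A : set mv_space, nbhs w A &
        {in A &, injective mv_proj};
  _ : forall w g, Hcov g -> mv_proj (mv_act w g) = mv_proj w *m g.1;
  _ : forall w, mv_act w Hone = w;
  _ : forall w g g', Hcov g -> Hcov g' ->
        mv_act (mv_act w g) g' = mv_act w (Hmul g g');
  _ : {within [set q : mv_space * ('M[C]_N * 'rV[C]_l) | Hcov q.2],
        continuous (fun q => mv_act q.1 q.2)}
}.

(* s is the germ at proj w of the inverse of proj sending proj w to w; u \o s is
   then the branch at w of the multivalued function u. *)
Definition local_section (W : mvdomain) (w : W) (s : 'M[C]_(2, N) -> W) : Prop :=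
  [/\ s (mv_proj w) = w, {for mv_proj w, continuous s}
    & \forall z \near mv_proj w, mv_proj (s z) = z].

Definition SolI (W : mvdomain) (u : W -> C) : Prop :=
  forall (w : W) (s : 'M[C]_(2, N) -> W), local_section w s ->
    holomorphic_at (u \o s) (mv_proj w) /\
    forall (p q : 'I_l) (a : 'I_(m p).+1) (b : 'I_(m q).+1),
      box a b (u \o s) (mv_proj w) = 0.

Definition Salpha (alpha : 'rV[C]_N) (W : mvdomain) (u : W -> C) : Prop :=
  SolI u /\
  forall (w : W) (g : 'M[C]_N * 'rV[C]_l), Hcov g ->
    u (mv_act w g) = u w * chi alpha g.

End Confluent.

(* Main.v *)
(** The second row of z h = x forces h^-1 = z_1(Lambda) blockwise, so that
    changing only the last column of the block i, by t in the row r, leaves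
    every coordinate of x but x^(i)_(n_i - 1) fixed: with h_0 = h^(i)_0 for the
    new point, that coordinate moves by t h_0 if r = 0 and by - t x^(i)_0 h_0 if
    r = 1.  Meanwhile chi(h^-1) is constant if r = 0 and has logarithmic
    derivative alpha^(i)_(n_i - 1) h_0 if r = 1; for n_i = 1 this is the
    derivative of alpha^(i)_0 log z_(1,0), otherwise it comes from theta_(n_i -
    1)(x + t T^(n_i - 1)) = theta_(n_i - 1)(x) + t / x_0.  Applying these one
    variable derivatives twice gives the induced operator.

    For u in S(alpha) the equivariance under exp (t Lambda^(n_k - 1)) gives, on
    all of Z_lambda, the Euler equation
      z^(k)_(0,0) d_0 u + z^(k)_(1,0) d_1 u = alpha^(k)_(n_k - 1) u
    for the derivatives in the last column of the block k.  On X it eliminates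
    the derivatives d_1 from the equation box u = 0, leaving Mtilde u = 0. *)
Require Import Defs.
From HB Require Import structures.
From mathcomp Require Import all_boot all_order all_algebra.
From mathcomp Require Import complex finmap.
From mathcomp Require Import all_classical all_reals all_analysis.
From mathcomp Require Import ring.
From mathcomp.analysis.showcase Require Import summability.
Set Implicit Arguments.
Unset Strict Implicit.
Unset Printing Implicit Defensive.
Import Order.TTheory GRing.Theory Num.Theory numFieldNormedType.Exports.
Local Open Scope classical_set_scope.
Local Open Scope ring_scope.

(** * Derivatives along lines *)

(** Holomorphy is given as unconditional convergence of a power series, and the series is never
    differentiated term by term. A bound for the finite sums of |c_nu| r^|nu| controls everything
    beyond finitely many monomials. It yields the two facts that are used: the derivative along v is
    linear in v, and mixed second derivatives in two distinct variables exist and agree. The branch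
    g is only assumed continuous. Its matrix part is determined by z, and its logarithms become
    differentiable because the exponential has a nonvanishing derivative. Up to the factor h^(j)_0,
    a derivative in the last column of the block j turns a function chi(h^-1) v(x) into another one
    of this form. As h^(j)_0 is constant along the last column of a block i other than j, the one
    variable formula applies a second time. The equation on X is not read off from the induced
    operator: this would require a continuous choice of g near X and a comparison with u under the
    whole group, whereas the Euler equations need one subgroup per block and only small t. *)

Section Derivatives.
Variables (K : numFieldType).

(** The estimate is stated on a full neighbourhood of 0, being trivial at t = 0, so that the error
    bounds below need neither quotients nor punctured neighbourhoods. *)
Lemma is_derive_approxP (V W : normedModType K) (f : V -> W) z v df :
  is_derive z v f df <-> forall e, 0 < e ->
    \forall t \near (0 : K), `|f (t *: v + z) - f z - t *: df| <= e * `|t|.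
Proof.
split=> [[fz <-] e e0|fz].
  have /derivable_nbhsP/eqaddoP/(_ _ e0) := fz; apply: filterS => t /=.
  rewrite -![(_ + _ : _ -> _) _]/(_ + _) -![(- _ : _ -> _) _]/(- _) /cst /=.
  by rewrite opprD addrA.
have fzv : h^-1 *: ((f \o shift z) (h *: v) - f z) @[h --> 0^'] --> df.
  apply/cvgrPdist_le => e e0; rewrite near_withinE; near=> t => t0.
  rewrite -[X in X - _]scale1r -(@mulVf _ t)// -scalerA -scalerBr normrZ normfV.
  rewrite ler_pdivrMl ?normr_gt0// mulrC distrC /=.
  by near: t; exact: fz.
split; first by apply/cvg_ex; exists df.
exact/cvg_lim.
Unshelve. all: by end_near. Qed.

Lemma is_derive_lineP (V W : normedModType K) (f : V -> W) z v df :
  is_derive z v f df <-> is_derive (0 : K) 1 (fun t : K => f (t *: v + z)) df.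
Proof.
rewrite !is_derive_approxP; split=> fz e /fz; apply: filterS => t;
  by rewrite addr0 scale0r add0r [_%:A]mulr1.
Qed.

Lemma is_derive_near_line (V W : normedModType K) (f : V -> W) (g : K -> W)
    z v df :
  (\forall t \near (0 : K), f (t *: v + z) = g t) ->
  is_derive (0 : K) 1 g df -> is_derive z v f df.
Proof.
move=> fg dg; apply/is_derive_lineP; apply: near_eq_is_derive dg.
by apply: filterS fg => t ->.
Qed.

(** The form in which tails of power series deliver a derivative. *)
Lemma is_derive_quadratic (V W : normedModType K) (f : V -> W) z v df M :
  0 <= M ->
  (\forall t \near (0 : K),
     `|f (t *: v + z) - f z - t *: df| <= M * `|t| ^+ 2) ->
  is_derive z v f df.
Proof.
move=> M0 fM; apply/is_derive_approxP => e e0.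
have M1 : 0 < M + 1 by rewrite ltr_wpDl.
have t_small : \forall t \near (0 : K), `|t| <= e / (M + 1).
  by apply: (@nbhs0_le _ K^o); rewrite divr_gt0.
near=> t; apply: le_trans (_ : M * `|t| ^+ 2 <= _); first by near: t.
rewrite expr2 mulrA ler_wpM2r//.
apply: le_trans (_ : (M + 1) * `|t| <= _).
  by rewrite ler_wpM2r// lerDl.
by rewrite mulrC -ler_pdivlMr//; near: t.
Unshelve. all: by end_near. Qed.

Lemma is_derive_lipschitz (V W : normedModType K) (f : V -> W) z v df :
  is_derive z v f df ->
  \forall t \near (0 : K), `|f (t *: v + z) - f z| <= (`|df| + 1) * `|t|.
Proof.
move=> /is_derive_approxP/(_ 1 ltr01); apply: filterS => t.
rewrite mulrDl => tz.
rewrite -[leLHS]/(`|_|) -(subrK (t *: df) (f _ - f z)).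
by rewrite (le_trans (ler_normD _ _))// addrC lerD// normrZ mulrC.
Qed.

Lemma near0_norm_small (V : normedModType K) (r : K -> V) (B e : K) :
  0 <= B -> 0 < e -> (\forall t \near (0 : K), `|r t| <= B * `|t|) ->
  \forall t \near (0 : K), `|r t| <= e.
Proof.
move=> B0 e0 rB.
have B1 : 0 < B + 1 by rewrite ltr_wpDl.
have t_small : \forall t \near (0 : K), `|t| <= e / (B + 1).
  by apply: (@nbhs0_le _ K^o); rewrite divr_gt0.
near=> t; apply: le_trans (_ : B * `|t| <= _); first by near: t.
apply: le_trans (_ : (B + 1) * `|t| <= _); first by rewrite ler_wpM2r// lerDl.
by rewrite mulrC -ler_pdivlMr//; near: t.
Unshelve. all: by end_near. Qed.

Lemma near0_norm_le (V : normedModType K) (r : K -> V) (B : K) :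
  0 <= B -> (\forall t \near (0 : K), `|r t| <= B * `|t|) ->
  r t @[t --> (0 : K)] --> (0 : V).
Proof.
move=> B0 rB; apply/(@cvgr0Pnorm_le _ _ _ _ (nbhs_filter (0 : K^o))) => e e0.
exact: near0_norm_small rB.
Qed.

Lemma near_line (V : normedModType K) (P : set V) (z v : V) :
  (\forall x \near z, P x) -> \forall t \near (0 : K), P (t *: v + z).
Proof.
move=> /nbhs_ballP[d /= d0 dP].
have v1 : 0 < `|v| + 1 by rewrite ltr_wpDl.
have t_small : \forall t \near (0 : K), `|t| < d / (`|v| + 1).
  by apply: (@nbhs0_lt _ K^o); rewrite divr_gt0.
apply: filterS t_small => t; rewrite ltr_pdivlMr// => td; apply: dP.
rewrite -ball_normE /ball_/= opprD addrCA subrr addr0 normrN normrZ.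
by apply: le_lt_trans td; rewrite ler_wpM2l// lerDl.
Qed.

Lemma near0_exists_neq0 (P : set K) :
  (\forall t \near (0 : K), P t) -> exists2 t : K, t != 0 & P t.
Proof.
move=> /nbhs_ballP[d /= d0 dP]; have d2 : 0 < d / 2 by rewrite divr_gt0.
exists (d / 2); first by rewrite gt_eqF.
apply: dP; rewrite -ball_normE /ball_/= sub0r normrN gtr0_norm//.
by rewrite ltr_pdivrMr// ltr_pMr// ltr1n.
Qed.

(** Only a derivative of [f] along [v] is assumed. The outer function has one variable, and the
    increment of [f] is O(t) by [is_derive_lipschitz], so that the remainder of [g] at that
    increment is o(t). *)
Lemma is_derive_comp1 (V W : normedModType K) (f : V -> K) (g : K -> W)
    z v df dg :
  is_derive z v f df -> is_derive (f z) 1 g dg ->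
  is_derive z v (g \o f) (df *: dg).
Proof.
move=> df_ dg_; apply/is_derive_approxP => e e0.
have f_lip := is_derive_lipschitz df_.
have d0 : 0 < `|df| + 1 by rewrite ltr_wpDl.
have g0 : 0 < `|dg| + 1 by rewrite ltr_wpDl.
have /is_derive_approxP/(_ (e / 2 / (`|df| + 1))) := dg_.
rewrite !divr_gt0// => /(_ isT) g_app.
have /is_derive_approxP/(_ (e / 2 / (`|dg| + 1))) := df_.
rewrite !divr_gt0// => /(_ isT) f_app.
have f_cvg : f (t *: v + z) - f z @[t --> (0 : K)] --> (0 : K).
  by apply: (@near0_norm_le K^o _ (`|df| + 1)) => //; exact: ltW.
have g_near : \forall t \near (0 : K),
    `|g (f (t *: v + z)) - g (f z) - (f (t *: v + z) - f z) *: dg| <=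
    e / 2 / (`|df| + 1) * `|f (t *: v + z) - f z|.
  apply: (@filterS _ (nbhs (0 : K)) _ _ _ _ (f_cvg _ g_app)) => t /=.
  by rewrite [_%:A]mulr1 subrK.
near=> t.
have split_term (A : W) (b c : K) :
    A - c *: dg = A - b *: dg + (b - c) *: dg.
  by rewrite scalerBl addrA subrK.
rewrite scalerA [_ - _ *: dg](split_term _ (f (t *: v + z) - f z)).
rewrite (le_trans (ler_normD _ _))// (splitr e) mulrDl lerD//.
  apply: le_trans (_ : e / 2 / (`|df| + 1) * `|f (t *: v + z) - f z| <= _).
    by near: t.
  rewrite -mulrA ler_wpM2l ?divr_ge0 ?(ltW e0)// ler_pdivrMl//.
  by near: t.
rewrite normrZ; apply: le_trans (_ : e / 2 / (`|dg| + 1) * `|t| * `|dg| <= _).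
  by rewrite ler_wpM2r//; near: t; exact: f_app.
rewrite -[leLHS]mulrA [ `|t| * _]mulrC mulrA ler_wpM2r// -[leLHS]mulrA.
rewrite ger_pMr ?divr_gt0//.
by rewrite ler_pdivrMl// mulr1 lerDl.
Unshelve. all: by end_near. Qed.

Lemma is_derive_reparam (V W : normedModType K) (f : V -> W) z v df
    (phi : K -> K) dphi :
  phi 0 = 0 -> is_derive (0 : K) 1 phi dphi -> is_derive z v f df ->
  is_derive (0 : K) 1 (fun t => f (phi t *: v + z)) (dphi *: df).
Proof.
move=> phi0 dphi_ /is_derive_lineP df_.
by apply: (@is_derive_comp1 _ _ phi (fun t => f (t *: v + z))); rewrite ?phi0.
Qed.

(* No branch of the logarithm is needed: a continuous lift of a differentiable
   function through E is differentiable where E' <> 0. *)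
Lemma is_derive_lift (E w : K -> K) dE d :
  dE != 0 -> is_derive (w 0) 1 E dE -> 
  (forall e, 0 < e -> \forall t \near (0 : K), `|w t - w 0| <= e) ->
  is_derive (0 : K) 1 (E \o w) d -> is_derive (0 : K) 1 w (d / dE).
Proof.
move=> dE0 dE_ w_cont dEw.
have E_gt0 : 0 < `|dE| by rewrite normr_gt0.
have w_cvg : w t - w 0 @[t --> (0 : K)] --> (0 : K).
  exact/(@cvgr0Pnorm_le _ _ _ _ (nbhs_filter (0 : K^o))).
have E_app e : 0 < e -> \forall t \near (0 : K),
    `|E (w t) - E (w 0) - (w t - w 0) * dE| <= e * `|w t - w 0|.
  move=> e0; have /is_derive_approxP/(_ _ e0) := dE_.
  move=> E_app; apply: (@filterS _ (nbhs (0 : K)) _ _ _ _ (w_cvg _ E_app)).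
  move=> t /=.
  by rewrite [_%:A]mulr1 subrK.
have Ew_app e : 0 < e -> \forall t \near (0 : K),
    `|E (w t) - E (w 0) - t * d| <= e * `|t|.
  move=> e0; have /is_derive_approxP/(_ _ e0) := dEw; apply: filterS => t /=.
  by rewrite [_%:A]mulr1 addr0.
have diff_app e e' : 0 < e -> 0 < e' -> \forall t \near (0 : K),
    `|(w t - w 0) * dE - t * d| <= e * `|w t - w 0| + e' * `|t|.
  move=> e0 e'0; near=> t.
  have -> : (w t - w 0) * dE - t * d =
     - (E (w t) - E (w 0) - (w t - w 0) * dE) + (E (w t) - E (w 0) - t * d).
    by rewrite opprB addrA subrK.
  rewrite (le_trans (ler_normD _ _))// normrN lerD//; near: t.
    exact: E_app.
  exact: Ew_app.
(* With e = |dE|/2 and e' = 1, [diff_app] gives |dE| q <= (|dE|/2) q + (1 + |d|) |t| for q = |w t -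
   w 0|; absorbing the first term on the left leaves q <= L |t|. *)
pose L := (1 + `|d|) * 2 / `|dE|.
have L0 : 0 < L by rewrite /L divr_gt0// mulr_gt0// ltr_wpDr.
have w_lip : \forall t \near (0 : K), `|w t - w 0| <= L * `|t|.
  have h2 : 0 < `|dE| / 2 by rewrite divr_gt0.
  have := diff_app _ 1 h2 ltr01; apply: filterS => t ht.
  have := le_trans (lerB_dist _ _) ht.
  rewrite !normrM mul1r; set p := `|dE|; set q := `|w t - w 0| => {}ht.
  have p0 : p != 0 by rewrite gt_eqF.
  have -> : L * `|t| = `|t| * (1 + `|d|) / (p / 2) by rewrite /L -/p; field.
  rewrite ler_pdivlMr//.
  have -> : q * (p / 2) = (q * p - `|t| * `|d|) - p / 2 * q + `|t| * `|d|.
    by field.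
  by rewrite mulrDr mulr1 lerD2r lerBlDl.
apply/is_derive_approxP => e e0.
(* After [w_lip] and the division by |dE|, each of the two error terms contributes (e/2) |t|. *)
have h1 : 0 < e * `|dE| / 2 / L by rewrite !divr_gt0// mulr_gt0.
have h2 : 0 < e * `|dE| / 2 by rewrite !divr_gt0// mulr_gt0.
have d_app := diff_app _ _ h1 h2.
near=> t.
rewrite [_%:A]mulr1 addr0.
have -> : w t - w 0 - t *: (d / dE) = ((w t - w 0) * dE - t * d) / dE.
  by rewrite mulrBl mulfK// [t *: _]mulrA.
rewrite normrM normfV ler_pdivrMr//.
apply: (@le_trans _ _
  (e * `|dE| / 2 / L * `|w t - w 0| + e * `|dE| / 2 * `|t|)).
  by near: t.
apply: (@le_trans _ _
  (e * `|dE| / 2 / L * (L * `|t|) + e * `|dE| / 2 * `|t|)).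
  rewrite lerD2r ler_wpM2l//; first exact: ltW.
  by near: t.
rewrite mulrA divfK ?gt_eqF//.
by rewrite -mulrDl -splitr mulrAC.
Unshelve. all: by end_near. Qed.

Lemma is_derive_mul (V : normedModType K) (f g : V -> K) x v df dg :
  is_derive x v f df -> is_derive x v g dg ->
  is_derive x v (fun t => f t * g t) (df * g x + f x * dg).
Proof.
move=> df_ dg_; have fg := is_deriveM df_ dg_.
apply: (@is_derive_eq K V K^o _ _ _ _ _ fg).
by rewrite addrC; congr (_ + _); exact: mulrC.
Qed.

Lemma is_derive_cmul (V : normedModType K) (c : K) (f : V -> K) x v df :
  is_derive x v f df -> is_derive x v (fun t => c * f t) (c * df).
Proof. by move=> df_; exact: (is_deriveZ c df_). Qed.

Lemma is_derive_add (V : normedModType K) (f g : V -> K) x v df dg :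
  is_derive x v f df -> is_derive x v g dg ->
  is_derive x v (fun t => f t + g t) (df + dg).
Proof. by move=> df_ dg_; exact: (is_deriveD df_ dg_). Qed.

Lemma is_derive_addr_cst (V : normedModType K) (f : V -> K) (c : K) x v df :
  is_derive x v f df -> is_derive x v (fun t => f t + c) df.
Proof.
by move=> df_; rewrite -[df]addr0; apply: is_derive_add.
Qed.

Lemma is_derive_id_mul (u : K -> K) du : is_derive (0 : K) 1 u du ->
  is_derive (0 : K) 1 (fun t => t * u t) (u 0).
Proof.
move=> du_; have id_u := is_derive_mul (@is_derive_id K K^o 0 1) du_.
apply: (@is_derive_eq K K^o K^o _ _ _ _ _ id_u).
by rewrite mul1r mul0r addr0.
Qed.

Lemma is_derive_sumr (V : normedModType K) n (h : 'I_n -> V -> K) x v dh :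
  (forall k, is_derive x v (h k) (dh k)) ->
  is_derive x v (fun t => \sum_k h k t) (\sum_k dh k).
Proof. by move=> /is_derive_sum; rewrite fct_sumE. Qed.

Lemma is_derive_inv_affine (c b : K) : c != 0 ->
  is_derive (0 : K) 1 (fun t => (c + t * b)^-1) (- b / c ^+ 2).
Proof.
move=> c0.
have aff : is_derive (0 : K) 1 (fun t : K => c + t * b) b.
  apply/is_derive_approxP => e e0; apply/nbhs_ballP; exists 1 => //= t _.
  have -> : c + (t%:A + 0) * b - (c + 0 * b) - t *: b = 0.
    by rewrite /GRing.scale/=; ring.
  by rewrite normr0 mulr_ge0// ltW.
have c0' : c + 0 * b != 0 by rewrite mul0r addr0.
have [aff1 aff2] := aff; pose a (t : K^o) : K := c + t * b.
split; first exact: (@derivableV K K^o a 0 1 c0' aff1).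
rewrite (@deriveV K K^o a 0 1 c0' aff1) aff2 /a mul0r addr0.
by rewrite [_ *: b]mulrC mulrN mulNr.
Qed.

(** The factor need only be constant on the line through [x]: this is how h^(j)_0 and x^(j)_0 pass
    through derivatives in the block i. *)
Lemma is_derive_mul_locally_constant (V : normedModType K) (c f : V -> K)
    x v df :
  (\forall t \near (0 : K), c (t *: v + x) = c x) ->
  is_derive x v f df -> is_derive x v (fun t => c t * f t) (c x * df).
Proof.
move=> cx /is_derive_lineP df_.
apply: (@is_derive_near_line _ _ _ (fun t => c x * f (t *: v + x))).
by apply: filterS cx => t ->.
Qed.

End Derivatives.

(** * Power series *)

Lemma mx_entry_le_norm (K : numFieldType) m n (x : 'M[K]_(m, n)) i j :
  `|x i j| <= `|x|.
Proof.
rewrite -[leRHS]/(mx_norm x) mx_normE -[leLHS]nngE num_le.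
exact: (le_bigmax _ (fun k => `|x k.1 k.2|%:nng) (i, j)).
Qed.

Lemma mx_norm_le_entries (K : numFieldType) m n (x : 'M[K]_(m, n)) B :
  0 <= B -> (forall i j, `|x i j| <= B) -> `|x| <= B.
Proof.
move=> B0 xB; rewrite -[leLHS]/(mx_norm x).
by have [->//|/mx_norm_neq0[k ->]] := eqVneq (mx_norm x) 0.
Qed.

Section PowerSeries.
Variable R : realType.
Local Notation C := R[i]^o.

Lemma sum_fsetUD (I : choiceType) (V : nmodType) (S A : {fset I}) (T : I -> V) :
  (S `<=` A)%fset ->
  \sum_(x <- A) T x = \sum_(x <- S) T x + \sum_(x <- (A `\` S)%fset) T x.
Proof.
move=> SA; rewrite (big_fsetID _ (mem S))/=; congr (_ + _).
  apply: eq_fbigl => x; rewrite !inE/=; apply/andP/idP => [[]//|xS].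
  by split=> //; exact: (fsubsetP SA).
by apply: eq_fbigl => x; rewrite !inE/= andbC.
Qed.

Lemma partial_sumE (I : choiceType) (x : I -> C) (A : {fset I}) :
  partial_sum x A = \sum_(i <- A) x i.
Proof. by rewrite /partial_sum big_seq_fsetE. Qed.

Lemma sum_norm_le_partial (I : choiceType) (F : realDomainType) (x : I -> F)
    (B : F) (D : {fset I}) :
  (forall A : {fset I}, (A `<=` D)%fset -> `|\sum_(i <- A) x i| <= B) ->
  \sum_(i <- D) `|x i| <= B *+ 2.
Proof.
move=> xB; rewrite (big_fsetID _ (fun i => 0 <= x i)) mulr2n lerD//.
  apply: le_trans (xB _ (fset_sub _ _)).
  apply: le_trans (ler_norm _); rewrite le_eqVlt big_seq [X in _ == X]big_seq.
  by apply/orP; left; apply/eqP; apply: eq_bigr => i;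
    rewrite !inE/= => /andP[_ /ger0_norm].
apply: le_trans (xB _ (fset_sub _ _)).
rewrite -normrN; apply: le_trans (ler_norm _).
rewrite -sumrN le_eqVlt big_seq [X in _ == X]big_seq.
apply/orP; left; apply/eqP; apply: eq_bigr => i.
by rewrite !inE/= -ltNge => /andP[_ /ltr0_norm].
Qed.

Lemma complex_norm_le (x : R[i]) :
  `|x| <= (`|complex.Re x| + `|complex.Im x|)%:C%C.
Proof.
rewrite {1}[x]complexE (le_trans (ler_normD _ _))// rmorphD/= lerD//.
  by rewrite normc_def/= expr0n addr0 sqrtr_sqr.
rewrite normrM !normc_def/= !expr0n/= !addr0 add0r expr1n !sqrtr1.
by rewrite mul1r sqrtr_sqr.
Qed.

Lemma complex_Im_le_norm (x : R[i]) : `|complex.Im x|%:C%C <= `|x|.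
Proof. by rewrite normc_def lecR -sqrtr_sqr ler_wsqrtr// lerDr sqr_ge0. Qed.

(* Beyond some finite J all finite sums have norm at most 2; selecting the terms
   whose real (or imaginary) part has a given sign makes them bound the sum of
   the norms. *)
Lemma totally_cvg_sum_bounded (I : choiceType) (x : I -> C) (l : C) :
  partial_sum x @ totally --> l ->
  exists2 M : R[i], 0 <= M &
    forall A : {fset I}, \sum_(i <- A) `|x i| <= M.
Proof.
move=> /(@cvgrPdist_le _ _ _ _ (@totally_filter I))/(_ 1 ltr01)[J _ Jx].
have disj_le (A : {fset I}) : [disjoint A & J]%fset ->
    `|\sum_(i <- A) x i| <= 2.
  move=> AJ; have JU : (J `<=` J `|` A)%fset := fsubsetUl _ _.
  have /= := Jx _ JU; rewrite partial_sumE (sum_fsetUD _ JU).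
  rewrite fsetDUl fsetDv fset0U.
  rewrite (fsetDidPl _ _ AJ) => h1.
  have /= := Jx _ (fsubset_refl J); rewrite partial_sumE distrC => h2.
  rewrite -[leLHS]normrN.
  set s := \sum_(i <- J) x i in h1 h2; set a := \sum_(i <- A) x i in h1 *.
  have -> : - a = (l - (s + a)) + (s - l) by ring.
  by rewrite (le_trans (ler_normD _ _))// lerD.
(* Outside J, the terms of each sign have sum at most 2 in absolute value, for the real and for the
   imaginary parts: 4 times 2. *)
exists (\sum_(i <- J) `|x i| + 8%:R).
  by rewrite addr_ge0// sumr_ge0.
move=> A; rewrite (big_fsetID _ (mem J))/= lerD//.
  rewrite [leRHS](@sum_fsetUD _ _ [fset i in A | i \in J]%fset)/=.
    by rewrite lerDl sumr_ge0.
  by apply/fsubsetP => i; rewrite !inE/= => /andP[].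
set D := [fset _ in A | _]%fset.
have DJ B : (B `<=` D)%fset -> [disjoint B & J]%fset.
  move=> /fsubsetP BD; apply/fdisjointP => i /BD.
  by rewrite !inE/= => /andP[].
apply: (@le_trans _ _
  (\sum_(i <- D) (`|complex.Re (x i)| + `|complex.Im (x i)|)%:C%C)).
  by apply: ler_sum => i _; exact: complex_norm_le.
have -> : 8%:R = (2 *+ 2 + 2 *+ 2 : R)%:C%C 
  by rewrite (_ : _ + _ = 8%:R) ?rmorph_nat//; ring.
rewrite -rmorph_sum/= lecR big_split/= lerD//.
  apply: sum_norm_le_partial => B /DJ/disj_le.
  rewrite -(rmorph_nat (real_complex R)).
  move/(le_trans (normc_ge_Re _)); rewrite lecR.
  by rewrite (raddf_sum (@complex.Re R : Rcomplex R -> R)).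
apply: sum_norm_le_partial => B /DJ/disj_le.
rewrite -(rmorph_nat (real_complex R)).
move/(le_trans (complex_Im_le_norm _)); rewrite lecR.
by rewrite (raddf_sum (@complex.Im R : Rcomplex R -> R)).
Qed.

(** Every finite set containing S has its sum within B M of the sum over S, and such sets are
    cofinal. In the uses, S is a set of low order monomials, [W] is |c_nu| r^|nu|, and B is the
    small factor gained from the order of the others. *)
Lemma partial_sum_tail_le (I : choiceType) (T : I -> C) (l : C) (S : {fset I})
    (W : I -> R[i]) (B M : R[i]) :
  partial_sum T @ totally --> l -> 0 <= B ->
  (forall A : {fset I}, \sum_(i <- A) W i <= M) ->
  (forall i, i \notin S -> `|T i| <= B * W i) ->
  `|l - \sum_(i <- S) T i| <= B * M.
Proof.
move=> Tl B0 WM TW; apply/ler_addgt0Pr => e e0.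
have [J _ Jx] := (@cvgrPdist_le _ _ _ _ (@totally_filter I) _ _).1 Tl e e0.
have := Jx _ (fsubsetUl J S); rewrite /= partial_sumE.
rewrite (sum_fsetUD _ (fsubsetUr J S)).
set s := \sum_(i <- S) _; set t := \sum_(i <- _) _ => lst.
have -> : l - s = t + (l - (s + t)) by ring.
rewrite (le_trans (ler_normD _ _))// lerD//.
apply: le_trans (ler_norm_sum _ _ _) _.
apply: (@le_trans _ _ (\sum_(i <- ((J `|` S) `\` S)%fset) B * W i)).
  rewrite big_seq [leRHS]big_seq; apply: ler_sum => i.
  by rewrite inE => /andP[/TW].
by rewrite -mulr_sumr ler_wpM2l.
Qed.

Variables a b : nat.
Local Notation I := ('I_a * 'I_b)%type.
Implicit Types (f : 'M[C]_(a, b) -> C) (z d : 'M[C]_(a, b)).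

Definition monomial d (nu : {ffun I -> nat}) : C :=
  \prod_(e : I) d e.1 e.2 ^+ nu e.

Definition degree (nu : {ffun I -> nat}) : nat := (\sum_(e : I) nu e)%N.

(** At the point all of whose coordinates are r, the terms have norm |c_nu| r^|nu|, and
    unconditional convergence there bounds their finite sums. Half the radius keeps this point
    inside the domain of convergence. *)
Lemma holomorphic_bounded f z : holomorphic_at f z ->
  exists (c : {ffun I -> nat} -> C) (r M : R[i]),
  [/\ 0 < r, 0 <= M,
      forall A : {fset {ffun I -> nat}},
        \sum_(nu <- A) `|c nu| * r ^+ degree nu <= M
    & forall d, `|d| <= r ->
        partial_sum (fun nu => c nu * monomial d nu) @ totally --> f (d + z)].
Proof.
move=> [c /nbhs_ballP[r0 /= r00 cr]].
have cvg d : `|d| < r0 ->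
    partial_sum (fun nu => c nu * monomial d nu) @ totally --> f (d + z).
  move=> dr; have := cr (d + z); rewrite -ball_normE /ball_/= opprD addrCA.
  rewrite subrr addr0 normrN => /(_ dr).
  by rewrite addrK.
pose r := r0 / 2; have r_gt0 : 0 < r by rewrite divr_gt0.
have r_lt : r < r0 by rewrite ltr_pdivrMr// ltr_pMr// ltr1n.
have /cvg/totally_cvg_sum_bounded[M M0 cM] :
    `|const_mx r : 'M[C]_(a, b)| < r0.
  apply: le_lt_trans r_lt.
  apply: mx_norm_le_entries => [|i j]; first exact: ltW.
  by rewrite mxE ger0_norm// ltW.
exists c, r, M; split=> // [A|d dr]; last exact/cvg/(le_lt_trans dr).
apply: le_trans (cM A); apply: ler_sum => nu _.
rewrite normrM /degree -prodrXr; rewrite /monomial normr_prod.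
rewrite le_eqVlt; apply/orP; left; apply/eqP; congr (_ * _).
by apply: eq_bigr => e _; rewrite normrX mxE ger0_norm// ltW.
Qed.

Definition unit_index (e : I) : {ffun I -> nat} := [ffun k => (k == e : nat)].

Lemma unit_index_inj : injective unit_index.
Proof.
by move=> e e' /ffunP/(_ e); rewrite !ffunE eqxx; case: eqP => // ->.
Qed.

Lemma monomial_unit d e : monomial d (unit_index e) = d e.1 e.2.
Proof.
rewrite /monomial (bigD1 e)//= ffunE eqxx expr1 big1 ?mulr1// => k ke.
by rewrite ffunE (negPf ke).
Qed.

Lemma degree_eq0 nu : degree nu = 0%N -> nu = [ffun=> 0%N].
Proof.
move=> /eqP; rewrite sum_nat_eq0 => /forallP nu0; apply/ffunP => e.
by rewrite ffunE; apply/eqP/(implyP (nu0 e)).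
Qed.

Lemma degree_eq1 nu : degree nu = 1%N -> exists e, nu = unit_index e.
Proof.
move=> /eqP/sum_nat_eq1[e [_ nue nu0]]; exists e; apply/ffunP => k.
by rewrite ffunE; have [->|/nu0->] := eqVneq k e.
Qed.

Lemma norm_monomial_le d nu (r x : R[i]) : 0 < r -> `|d| <= x ->
  `|monomial d nu| <= (x / r) ^+ degree nu * r ^+ degree nu.
Proof.
move=> r0 dx; rewrite -exprMn divfK ?gt_eqF// /degree -prodrXr normr_prod.
apply: ler_prod => e _; rewrite normr_ge0/= normrX lerXn2r ?nnegrE//.
  exact: le_trans dx.
by apply: le_trans dx; exact: mx_entry_le_norm.
Qed.

(** The numbers [L e] are the coefficients of degree one. Once the degrees 0 and 1 are removed,
    every monomial is at most (|d|/r)^2 r^|nu|, so that the remainder is quadratic in all directions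
    at once. *)
Lemma holomorphic_is_derive f z : holomorphic_at f z ->
  exists L : I -> C, forall v : 'M[C]_(a, b),
    is_derive z v f (\sum_e v e.1 e.2 * L e).
Proof.
move=> /holomorphic_bounded[c [r [M [r0 M0 cM f_sum]]]].
exists (c \o unit_index) => v.
pose S := ([ffun=> 0%N] |` [fset unit_index e | e : I])%fset.
have S_sum d : \sum_(nu <- S) c nu * monomial d nu =
    c [ffun=> 0%N] + \sum_e d e.1 e.2 * c (unit_index e).
  rewrite big_fsetU1/=; last first.
    apply/imfsetP => -[e _ /ffunP/(_ e)].
    by rewrite !ffunE eqxx.
  rewrite /monomial [X in c _ * X]big1 ?mulr1; last first.
    by move=> e _; rewrite ffunE.
  congr (_ + _); rewrite big_imfset/=; last by move=> ? ? _ _ /unit_index_inj.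
  rewrite big_enum/=; apply: eq_bigr => e _.
  by rewrite mulrC -[in RHS](monomial_unit d).
have f_tail d : `|d| <= r ->
    `|f (d + z) - (c [ffun=> 0%N] + \sum_e d e.1 e.2 * c (unit_index e))| <=
    (`|d| / r) ^+ 2 * M.
  move=> dr; rewrite -S_sum.
  have d_r : `|d| / r <= 1 by rewrite ler_pdivrMr// mul1r.
  apply: (partial_sum_tail_le (f_sum _ dr) _ cM).
    by rewrite exprn_ge0// divr_ge0// ltW.
  move=> nu nuS; rewrite normrM mulrCA ler_wpM2l//.
  apply: le_trans (norm_monomial_le _ r0 (lexx _)) _.
  rewrite ler_wpM2r ?exprn_ge0 ?(ltW r0)//.
  case deg : (degree nu) => [|[|k]].
  - by case/negP: nuS; rewrite (degree_eq0 deg) fset1U1.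
  - case/negP: nuS; have [e ->] := degree_eq1 deg.
    by apply/fsetUP; right; apply/imfsetP; exists e.
  - by rewrite ler_wiXn2l// divr_ge0// ltW.
have f_z : f z = c [ffun=> 0%N].
  have := f_tail 0; rewrite normr0 ltW// => /(_ isT).
  rewrite mul0r expr0n/= mul0r add0r big1 ?addr0; last first.
    by move=> e _; rewrite mxE mul0r.
  by rewrite normr_le0 subr_eq0 => /eqP.
apply: (@is_derive_quadratic _ _ _ _ _ _ _ ((`|v| / r) ^+ 2 * M)).
  by rewrite mulr_ge0// exprn_ge0// divr_ge0// ltW.
have v1 : 0 < `|v| + 1 by rewrite ltr_wpDl.
have t_small : \forall t \near (0 : C), `|t| <= r / (`|v| + 1).
  by apply: (@nbhs0_le _ R[i]^o); rewrite divr_gt0.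
apply: filterS t_small => t; rewrite ler_pdivlMr// => tr.
have tvr : `|t *: v| <= r.
  by rewrite normrZ; apply: le_trans tr; rewrite ler_wpM2l// lerDl.
have := f_tail _ tvr; rewrite normrZ f_z opprD addrA scaler_sumr.
under eq_bigr do rewrite mxE -mulrA.
move=> /le_trans; apply; rewrite le_eqVlt; apply/orP; left; apply/eqP.
by rewrite -(mulrA `|t|) exprMn -[LHS]mulrA mulrC.
Qed.

(** Linearity in the direction is what splits the derivative along the flow into the two partial
    derivatives of the Euler equation. *)
Lemma holomorphic_deriveE f z (v : 'M[C]_(a, b)) : holomorphic_at f z ->
  is_derive z v f (\sum_e v e.1 e.2 * 'D_(delta_mx e.1 e.2) f z).
Proof.
move=> /holomorphic_is_derive[L fL].
have LE e : 'D_(delta_mx e.1 e.2) f z = L e.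
  have [_ ->] := fL (delta_mx e.1 e.2).
  rewrite (bigD1 e)//= mxE !eqxx mul1r big1 ?addr0// => -[i j] /=.
  rewrite mxE; case: e => i' j' /=; rewrite xpair_eqE => /negPf ->.
  by rewrite mul0r.
by under eq_bigr do rewrite LE; exact: fL.
Qed.

Lemma monomial_plane (e e' : I) (s t : C) (nu : {ffun I -> nat}) : e != e' ->
  monomial (s *: delta_mx e.1 e.2 + t *: delta_mx e'.1 e'.2) nu =
  if [forall k, (k != e) && (k != e') ==> (nu k == 0%N)]
  then s ^+ nu e * t ^+ nu e' else 0.
Proof.
move=> ee'; have e'e : e' != e by rewrite eq_sym.
have entry k : (s *: delta_mx e.1 e.2 + t *: delta_mx e'.1 e'.2) k.1 k.2 =
    s * (k == e)%:R + t * (k == e')%:R.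
  by rewrite !mxE -!xpair_eqE -!surjective_pairing.
rewrite /monomial (bigD1 e)//= (bigD1 e')//= !entry !eqxx (negPf ee').
rewrite (negPf e'e) !mulr0 !mulr1 addr0 add0r mulrA.
case: ifPn => [/forallP nu0|/forallPn[k]].
  rewrite big1 ?mulr1// => k ke.
  by have := nu0 k; rewrite ke => /eqP->; rewrite expr0.
rewrite negb_imply => /andP[ke nuk]; rewrite (bigD1 k)//= entry.
case/andP: ke => /negPf-> /negPf->.
by rewrite !mulr0 addr0 expr0n (negPf nuk) mul0r mulr0.
Qed.

Lemma degree_plane (e e' : I) (nu : {ffun I -> nat}) : e != e' ->
  [forall k, (k != e) && (k != e') ==> (nu k == 0%N)] ->
  degree nu = (nu e + nu e')%N.
Proof.
move=> ee' /forallP nu0; rewrite /degree (bigD1 e)//= (bigD1 e') 1?eq_sym//=.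
by rewrite big1 ?addn0// => k ke; have := nu0 k; rewrite ke => /eqP.
Qed.

(* The difference in s kills the monomials without s, so that the error is
   divisible by s; this is what lets s tend to 0 for fixed t below. *)
Lemma holomorphic_plane f z : holomorphic_at f z ->
  exists (c : {ffun I -> nat} -> C) (r M : R[i]), [/\ 0 < r, 0 <= M &
    forall (e e' : I) (s t : C), e != e' -> `|s| + `|t| <= r ->
    `|f (s *: delta_mx e.1 e.2 + t *: delta_mx e'.1 e'.2 + z)
      - f (t *: delta_mx e'.1 e'.2 + z)
      - (s * c (unit_index e)
         + s * t * c [ffun k => unit_index e k + unit_index e' k]%N)| <=
    ((`|s| / r) ^+ 2 + `|s| / r * (`|t| / r) ^+ 2) * M].
Proof.
move=> /holomorphic_bounded[c [r [M [r0 M0 cM f_sum]]]].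
exists c, r, M; split=> // e e' s t ee' str.
have e'e : e' != e by rewrite eq_sym.
pose d := s *: delta_mx e.1 e.2 + t *: delta_mx e'.1 e'.2 : 'M[C]_(a, b).
pose d0 := t *: delta_mx e'.1 e'.2 : 'M[C]_(a, b).
have delta_le1 (k : I) : `|delta_mx k.1 k.2 : 'M[C]_(a, b)| <= 1.
  apply: mx_norm_le_entries => // i j; rewrite mxE.
  by case: (_ && _); rewrite ?normr1 ?normr0.
have d_le : `|d| <= r.
  apply: le_trans str; apply: le_trans (ler_normD _ _) _.
  by rewrite !normrZ lerD// ler_piMr.
have d0_le : `|d0| <= r.
  apply: le_trans str; rewrite normrZ.
  by apply: le_trans (_ : `|t| <= _); [rewrite ler_piMr|rewrite lerDr].
have d0E : d0 = 0 *: delta_mx e.1 e.2 + t *: delta_mx e'.1 e'.2.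
  by rewrite scale0r add0r.
have diff_sum : partial_sum
    (fun nu => c nu * (monomial d nu - monomial d0 nu)) @ totally
    --> f (d + z) - f (d0 + z).
  rewrite (_ : partial_sum _ = partial_sum (fun nu => c nu * monomial d nu) -
      partial_sum (fun nu => c nu * monomial d0 nu)).
    apply: (@cvgB _ C^o _ _ (@totally_filter _)); exact: f_sum.
  apply/funext => A; rewrite partial_sumE.
  rewrite -[RHS]/(partial_sum _ A - partial_sum _ A) !partial_sumE -sumrB.
  by apply: eq_bigr => nu _; rewrite mulrBr.
pose nu2 : {ffun I -> nat} := [ffun k => unit_index e k + unit_index e' k]%N.
pose S := [fset unit_index e; nu2]%fset.
have sub_sum : \sum_(nu <- S) c nu * (monomial d nu - monomial d0 nu) =
    s * c (unit_index e) + s * t * c nu2.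
  rewrite /S big_fsetU1/=; last first.
    rewrite inE; apply/eqP => /ffunP/(_ e').
    by rewrite !ffunE eqxx (negPf e'e).
  rewrite big_seq_fset1 !monomial_unit d0E !monomial_plane// !mxE !eqxx.
  rewrite (_ : [forall k, _]); last first.
    apply/forallP => k; apply/implyP => /andP[ke ke'].
    by rewrite !ffunE (negPf ke) (negPf ke').
  have -> : nu2 e = 1%N by rewrite !ffunE eqxx (negPf ee').
  have -> : nu2 e' = 1%N by rewrite !ffunE eqxx (negPf e'e).
  by rewrite /= !expr1; ring.
have sr0 : 0 <= `|s| / r by rewrite divr_ge0// ltW.
have tr0 : 0 <= `|t| / r by rewrite divr_ge0// ltW.
have sr1 : `|s| / r <= 1.
  by rewrite ler_pdivrMr// mul1r (le_trans _ str)// lerDl.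
have tr1 : `|t| / r <= 1.
  by rewrite ler_pdivrMr// mul1r (le_trans _ str)// lerDr.
have s2_0 : 0 <= (`|s| / r) ^+ 2 by exact: exprn_ge0.
have st_0 : 0 <= `|s| / r * (`|t| / r) ^+ 2.
  by apply: mulr_ge0 => //; exact: exprn_ge0.
have B0 : 0 <= (`|s| / r) ^+ 2 + `|s| / r * (`|t| / r) ^+ 2.
  exact: addr_ge0.
rewrite -sub_sum; apply: (partial_sum_tail_le diff_sum B0 cM).
move=> nu nuS; rewrite normrM mulrCA ler_wpM2l// d0E !monomial_plane//.
case: ifPn => [nu0|_]; last first.
  by rewrite subrr normr0 mulr_ge0// exprn_ge0// ltW.
rewrite (degree_plane ee' nu0).
have mono_norm : `|s ^+ nu e * t ^+ nu e'| =
    (`|s| / r) ^+ nu e * (`|t| / r) ^+ nu e' * r ^+ (nu e + nu e').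
  by rewrite normrM !normrX exprD [RHS]mulrACA -!exprMn !divfK ?gt_eqF.
(* Monomials without s cancel in the difference; those with s^2 give the first error term, those
   with s t^2 the second; s and s t are the elements of [S]. *)
have [nue0|nue0] := eqVneq (nu e) 0%N.
  by rewrite nue0 !expr0 subrr normr0 mulr_ge0// exprn_ge0// ltW.
rewrite expr0n (negPf nue0) mul0r subr0 mono_norm.
rewrite ler_wpM2r ?exprn_ge0 ?(ltW r0)//.
case nue : (nu e) nue0 => [//|[|k]] _; last first.
  rewrite -[leLHS]addr0 lerD//.
  apply: le_trans (ler_piMr _ _) _; first exact: exprn_ge0.
    exact: exprn_ile1.
  by rewrite ler_wiXn2l.
rewrite expr1 -[leLHS]add0r lerD// ler_wpM2l//.
case nue' : (nu e') => [|[|k]]; last by rewrite ler_wiXn2l.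
  case/negP: nuS; rewrite !inE; apply/orP; left; apply/eqP/ffunP => k.
  rewrite ffunE; have [->//|ke] := eqVneq k e; have [->//|ke'] := eqVneq k e'.
  by have /forallP/(_ k) := nu0; rewrite ke ke' => /eqP.
case/negP: nuS; rewrite !inE; apply/orP; right; apply/eqP/ffunP => k.
rewrite !ffunE; have [->|ke] := eqVneq k e; first by rewrite (negPf ee').
have [->//|ke'] := eqVneq k e'.
by have /forallP/(_ k) := nu0; rewrite ke ke' => /eqP.
Qed.

(** Both derivatives are the coefficient of the product of the two variables, which is symmetric in
    them. Dividing the estimate of [holomorphic_plane] by s and letting s tend to 0 at fixed t
    expands the first derivative to first order in t. *)
Lemma holomorphic_mixed f z (e e' : I) : e != e' ->
  (\forall z' \near z, holomorphic_at f z') ->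
  exists c : C,
    is_derive z (delta_mx e'.1 e'.2) ('D_(delta_mx e.1 e.2) f) c /\
    is_derive z (delta_mx e.1 e.2) ('D_(delta_mx e'.1 e'.2) f) c.
Proof.
move=> ee' f_hol.
have [c [r [M [r0 M0 f_plane]]]] := holomorphic_plane (nbhs_singleton f_hol).
pose c2 (k k' : I) := c [ffun l => unit_index k l + unit_index k' l]%N.
have c2C k k' : c2 k k' = c2 k' k.
  by rewrite /c2; congr c; apply/ffunP => l; rewrite !ffunE addnC.
suff mixed (k k' : I) : k != k' ->
    is_derive z (delta_mx k'.1 k'.2) ('D_(delta_mx k.1 k.2) f) (c2 k k').
  exists (c2 e e'); split; first exact: mixed.
  by rewrite c2C; apply: mixed; rewrite eq_sym.
move=> kk'.
have r2 : 0 < r / 2 by rewrite divr_gt0.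
have D_approx : \forall t \near (0 : C),
    `|'D_(delta_mx k.1 k.2) f (t *: delta_mx k'.1 k'.2 + z)
      - c (unit_index k) - t * c2 k k'| <= (`|t| / r) ^+ 2 / r * M.
  have t_small : \forall t \near (0 : C), `|t| <= r / 2.
    exact: (@nbhs0_le _ C).
  have t_hol : \forall t \near (0 : C),
      holomorphic_at f (t *: delta_mx k'.1 k'.2 + z).
    exact: (@near_line R[i] 'M[C]_(a, b) (holomorphic_at f) z _ f_hol).
  near=> t.
  have t_le : `|t| <= r / 2 by near: t.
  have : holomorphic_at f (t *: delta_mx k'.1 k'.2 + z) by near: t.
  move=> /(holomorphic_deriveE (delta_mx k.1 k.2))[dfx _].
  set D := 'D_(_) f _.
  have D_f := derivableP dfx; rewrite -/D in D_f.
  (* The limit in s is replaced by a single nonzero s, so small that the s^2 term and the remainder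
     of the derivative [D] each cost at most eps/2 after division by |s|. *)
  apply/ler_addgt0Pr => eps eps0.
  have eps2 : 0 < eps / 2 by rewrite divr_gt0.
  have /is_derive_approxP/(_ _ eps2) s_approx := D_f.
  have s_le1 : \forall s \near (0 : C), `|s| <= r / 2.
    exact: (@nbhs0_le _ C).
  have M1 : 0 < M + 1 by rewrite ltr_wpDl.
  have s_le2 : \forall s \near (0 : C), `|s| <= eps / 2 * r ^+ 2 / (M + 1).
    by apply: (@nbhs0_le _ C); rewrite divr_gt0// mulr_gt0// exprn_gt0.
  have s_near : \forall s \near (0 : C),
     [/\ `|f (s *: delta_mx k.1 k.2 + (t *: delta_mx k'.1 k'.2 + z))
         - f (t *: delta_mx k'.1 k'.2 + z) - s *: D| <= eps / 2 * `|s|,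
        `|s| <= r / 2 & `|s| <= eps / 2 * r ^+ 2 / (M + 1)].
    by near=> s; split; near: s.
  have [s s0 [s_app s_r s_eps]] := near0_exists_neq0 s_near.
  have str : `|s| + `|t| <= r by rewrite (splitr r) lerD.
  have := f_plane k k' s t kk' str.
  rewrite -/(c2 k k') -(addrA (s *: _)) => st_app.
  have s_gt0 : 0 < `|s| by rewrite normr_gt0.
  rewrite -(ler_pM2l s_gt0) -normrM.
  have -> : s * (D - c (unit_index k) - t * c2 k k') =
     (f (s *: delta_mx k.1 k.2 + (t *: delta_mx k'.1 k'.2 + z))
         - f (t *: delta_mx k'.1 k'.2 + z)
         - (s * c (unit_index k) + s * t * c2 k k'))
     - (f (s *: delta_mx k.1 k.2 + (t *: delta_mx k'.1 k'.2 + z))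
         - f (t *: delta_mx k'.1 k'.2 + z) - s *: D).
    by rewrite /GRing.scale/=; ring.
  apply: le_trans (ler_normB _ _) _.
  apply: le_trans (lerD st_app s_app) _.
  have s_M : `|s| * M <= eps / 2 * r ^+ 2.
    apply: le_trans (_ : `|s| * (M + 1) <= _).
      by rewrite ler_wpM2l// lerDl.
    by rewrite -ler_pdivlMr.
  have r_neq0 : r != 0 by rewrite gt_eqF.
  have -> : ((`|s| / r) ^+ 2 + `|s| / r * (`|t| / r) ^+ 2) * M + eps / 2 * `|s|
     = `|s| * ((`|t| / r) ^+ 2 / r * M + (`|s| * M / r ^+ 2 + eps / 2)).
    by field.
  rewrite ler_wpM2l// lerD2l [leRHS]splitr lerD2r.
  by rewrite ler_pdivrMr ?exprn_gt0.
have D0 : 'D_(delta_mx k.1 k.2) f z = c (unit_index k).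
  have := nbhs_singleton D_approx; rewrite scale0r add0r mul0r subr0 normr0.
  rewrite mul0r expr0n/= mul0r mul0r normr_le0 subr_eq0.
  by move/eqP.
apply: (@is_derive_quadratic _ _ _ _ _ _ _ (M / r ^+ 3)).
  by rewrite divr_ge0// exprn_ge0// ltW.
apply: filterS D_approx => t; rewrite D0 => /le_trans; apply.
have r_neq0 : r != 0 by rewrite gt_eqF.
by rewrite le_eqVlt; apply/orP; left; apply/eqP; field.
Unshelve. all: by end_near. Qed.

End PowerSeries.

(** * The complex exponential *)

Section ComplexExponential.
Variable R : realType.
Local Notation C := R[i]^o.

Lemma cexpD (x y : R[i]) : cexp (x + y) = cexp x * cexp y.
Proof.
case: x y => [a b] [c d]; rewrite /cexp /= expRD cosD sinD rmorphM/=.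
rewrite mulrACA; congr (_ * _); apply/eqP; rewrite eq_complex /=.
by rewrite eqxx /= addrC.
Qed.

Lemma cexp0 : cexp (0 : R[i]) = 1.
Proof. by rewrite /cexp /= expR0 cos0 sin0 mul1r. Qed.

Lemma cexp_neq0 (x : R[i]) : cexp x != 0.
Proof.
have /eqP : cexp x * cexp (- x) = 1 by rewrite -cexpD subrr cexp0.
by apply: contraTneq => ->; rewrite mul0r eq_sym oner_eq0.
Qed.

Lemma cexp_sum (J : Type) (r : seq J) (P : pred J) (F : J -> R[i]) :
  cexp (\sum_(k <- r | P k) F k) = \prod_(k <- r | P k) cexp (F k).
Proof. by apply: (big_morph _ cexpD cexp0). Qed.

Lemma near0_Re_Im (P : set R) : (\forall x \near (0 : R), P x) ->
  \forall t \near (0 : C), P (complex.Re t) /\ P (complex.Im t).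
Proof.
move=> /nbhs_ballP[d /= d0 dP]; apply/(@nbhs_ballP _ C).
exists (d%:C%C); first by rewrite /= ltcR.
move=> t; rewrite -ball_normE /ball_/= sub0r normrN => td.
split; apply: dP; rewrite /ball/= sub0r normrN -ltcR; apply: le_lt_trans td.
  exact: normc_ge_Re.
exact: complex_Im_le_norm.
Qed.

Lemma cexp_approx0 (e : R[i]) : 0 < e ->
  \forall t \near (0 : C), `|cexp t - 1 - t| <= e * `|t|.
Proof.
(* A positive element of [R[i]] has imaginary part 0, so that [e] is real. *)
case: e => [e e']; rewrite ltcE/= => /andP[/eqP-> e0].
rewrite -[(e +i* 0)%C]/(e%:C%C).
(* The errors add up to d |x| + 5 d |y|, at most 6 d |t| for t = x + iy. *)
pose d := e / 6; have d0 : 0 < d by rewrite divr_gt0.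
have exp_app : \forall x \near (0 : R), `|expR x - 1 - x| <= d * `|x|.
  have /is_derive_approxP/(_ _ d0) := is_derive_expR (0 : R).
  apply: filterS => x; rewrite [_%:A]mulr1 addr0 expR0.
  by rewrite [_ *: _]mulr1.
have sin_app : \forall x \near (0 : R), `|sin x - x| <= d * `|x|.
  have /is_derive_approxP/(_ _ d0) := is_derive_sin (0 : R).
  apply: filterS => x; rewrite [_%:A]mulr1 addr0 sin0 cos0 subr0.
  by rewrite [_ *: _]mulr1.
have cos_app : \forall x \near (0 : R), `|cos x - 1| <= d * `|x|.
  have /is_derive_approxP/(_ _ d0) := is_derive_cos (0 : R).
  apply: filterS => x; rewrite [_%:A]mulr1 addr0 sin0 cos0 oppr0.
  by rewrite scaler0 subr0.
(* The bound 1 gives |expR x| <= 2; the bound [d] controls the term (expR x - 1) y. *)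
have exp_cont : \forall x \near (0 : R), `|expR x - 1| <= Num.min d 1.
  have m0 : 0 < Num.min d 1 by rewrite lt_min d0/=.
  have /cvgrPdist_le/(_ _ m0) := @continuous_expR R 0.
  by apply: filterS => x; rewrite expR0 distrC.
have /near0_Re_Im : \forall x \near (0 : R),
    [/\ `|expR x - 1 - x| <= d * `|x|, `|sin x - x| <= d * `|x|,
        `|cos x - 1| <= d * `|x| & `|expR x - 1| <= Num.min d 1].
  by near=> x; split; near: x.
apply: filterS => -[x y] /= [[ex _ _ exc] [_ sy cy _]].
apply: le_trans (complex_norm_le _) _; rewrite -subr_ge0.
have x_le : `|x|%:C%C <= `|(x +i* y)%C| := normc_ge_Re (x +i* y)%C.
have y_le : `|y|%:C%C <= `|(x +i* y)%C| := complex_Im_le_norm (x +i* y)%C.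
have exp_le : `|expR x| <= 2.
  rewrite -(subrK 1 (expR x)) (le_trans (ler_normD _ _))// normr1 lerD2r.
  by rewrite (le_trans exc)// ge_min lexx orbT.
have exp_le' : `|expR x - 1| <= d by rewrite (le_trans exc)// ge_min lexx.
rewrite subr_ge0 {1}/cexp /=.
have -> : expR x * cos y - 0 * sin y - 1 - x =
    (expR x - 1 - x) + expR x * (cos y - 1) by ring.
have -> : expR x * sin y + 0 * cos y - 0 - y =
    expR x * (sin y - y) + (expR x - 1) * y by ring.
apply: (@le_trans _ _ ((d * `|x| + 5%:R * d * `|y|)%:C%C)).
  rewrite lecR.
  have -> : d * `|x| + 5%:R * d * `|y| =
      (d * `|x| + 2 * (d * `|y|)) + (2 * (d * `|y|) + d * `|y|) by ring.
  apply: lerD; apply: le_trans (ler_normD _ _) _; apply: lerD => //.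
  - by rewrite normrM ler_pM.
  - by rewrite normrM ler_pM.
  - by rewrite normrM ler_pM.
have -> : e%:C%C * `|(x +i* y)%C| =
  d%:C%C * `|(x +i* y)%C| + (5%:R * d)%:C%C * `|(x +i* y)%C|.
  by rewrite -mulrDl -rmorphD/=; congr (_%:C%C * _); rewrite /d; field.
rewrite rmorphD/= !(rmorphM (real_complex R))/=.
by apply: lerD; rewrite ler_wpM2l// -?rmorphM ler0c ?mulr_ge0// ltW.
Unshelve. all: by end_near. Qed.

Lemma is_derive_cexp (w : C) : is_derive w 1 (@cexp R : C -> C) (cexp w).
Proof.
apply/is_derive_approxP => e e0.
have w0 : 0 < `|cexp w| by rewrite normr_gt0 cexp_neq0.
have := cexp_approx0 (divr_gt0 e0 w0); apply: filterS => t.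
rewrite [_%:A]mulr1 cexpD mulrAC ler_pdivlMr// -normrM => cexp_t.
apply: le_trans cexp_t; rewrite le_eqVlt; apply/orP; left; apply/eqP.
congr (`|_|).
by rewrite !mulrBl mul1r.
Qed.

End ComplexExponential.

(** * Jordan blocks and the functions theta *)

Lemma mulmx_delta (K : pzRingType) p n q (A : 'M[K]_(p, n)) a (b : 'I_q) r c :
  (A *m delta_mx a b) r c = A r a * (c == b)%:R.
Proof.
rewrite mxE (bigD1 a)//= mxE eqxx big1 ?addr0// => d /negPf da.
by rewrite mxE da mulr0.
Qed.

Section Jordan.
Variable R : realType.
Local Notation C := R[i]^o.

Lemma shift_mxX n k (a b : 'I_n.+1) :
  (shift_mx R n ^+ k) a b = (a + k == b)%N%:R.
Proof.
elim: k a b => [|k IH] a b; first by rewrite expr0 mxE addn0.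
rewrite exprS !mxE; have [ak|ak] := ltnP a n; last first.
  rewrite big1 => [|c _]; last first.
    by rewrite !mxE gtn_eqF ?mul0r//; exact: leq_trans (ltn_ord c) _.
  rewrite gtn_eqF// (leq_trans (ltn_ord b))// addnS ltnS (leq_trans ak)//.
  exact: leq_addr.
have a1 : (a.+1 < n.+1)%N by [].
rewrite (bigD1 (Ordinal a1))//= IH !mxE eqxx mul1r addSnnS big1 ?addr0// => c.
rewrite -val_eqE /= => ca; rewrite !mxE.
by rewrite eq_sym (negPf ca) mul0r.
Qed.

Lemma jordan_entry n (B : 'M[C]_n.+1) : jordan B -> forall a b : 'I_n.+1,
  B a b = if (a <= b)%N then B ord0 (inord (b - a)) else 0.
Proof.
case=> _ [c ->] a b; rewrite !summxE.
under eq_bigr do rewrite mxE shift_mxX.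
have [ab|ab] := leqP a b; last first.
  by apply: big1 => k _; rewrite gtn_eqF ?mulr0// ltn_addr.
have ba : (b - a < n.+1)%N by rewrite (leq_ltn_trans (leq_subr _ _)).
apply: eq_bigr => k _; rewrite mxE shift_mxX inordK// add0n.
by rewrite -[in RHS](eqn_add2l a) subnKC.
Qed.

Lemma jordan_comm n (B B' : 'M[C]_n.+1) :
  jordan B -> jordan B' -> B *m B' = B' *m B.
Proof.
case=> _ [c ->] [_ [c' ->]].
apply: (@commr_sum _ _ _ _ _) => k' _; apply: commr_sym.
apply: commr_sum => k _.
rewrite /GRing.comm -!scalerAl -!scalerAr !scalerA mulrC.
by rewrite -!exprD addnC.
Qed.

(** The last basis row is a common left eigenvector of the group, with eigenvalue h_0: a change in
    the last column of a block stays in that column. *)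
Lemma jordan_last_row n (B : 'M[C]_n.+1) (t : C) : jordan B ->
  (t *: delta_mx 0 ord_max : 'rV_n.+1) *m B =
  (t * B ord0 ord0) *: delta_mx 0 ord_max.
Proof.
move=> JB; rewrite -scalemxAl -rowE; apply/rowP => b; rewrite !mxE eqxx/=.
rewrite -mulrA; congr (_ * _); rewrite (jordan_entry JB).
have [nb|nb] := leqP n b; last by rewrite -val_eqE/= ltn_eqF// mulr0.
have -> : b = ord_max by apply/val_inj/anti_leq; rewrite /= nb -ltnS ltn_ord.
rewrite eqxx mulr1 /= subnn; congr (B _ _); apply/val_inj.
by rewrite /= inordK.
Qed.

Lemma jordan_mul00 n (q : 'rV[C]_n.+1) (B : 'M[C]_n.+1) : jordan B ->
  (q *m B) ord0 ord0 = q ord0 ord0 * B ord0 ord0.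
Proof.
move=> JB; rewrite mxE (bigD1 ord0)//= big1 ?addr0// => k k0.
rewrite (jordan_entry JB) leqn0.
by rewrite -[_ == 0%N]/(k == ord0) (negPf k0) mulr0.
Qed.

(* Since B and B' commute, the first row of B' is p B B' = (p B') B, which is
   explicit; a matrix of the group is determined by its first row. *)
Lemma jordan_line n (B B' : 'M[C]_n.+1) (p p' q q' : 'rV[C]_n.+1) (s t : C) :
  jordan B -> jordan B' ->
  p *m B = delta_mx 0 ord0 -> p' *m B' = delta_mx 0 ord0 ->
  p' = s *: delta_mx 0 ord_max + p -> q' = t *: delta_mx 0 ord_max + q ->
  q' *m B' =
    ((t - s * (q *m B) ord0 ord0) * B' ord0 ord0) *: delta_mx 0 ord_max
    + q *m B.
Proof.
move=> JB JB' pB p'B' p'E q'E.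
set b := B ord0 ord0; set b' := B' ord0 ord0.
have B'_row : row ord0 B' = - (s * b' * b) *: delta_mx 0 ord_max + row ord0 B.
  have pB' : p *m B' = - (s * b') *: delta_mx 0 ord_max + delta_mx 0 ord0.
    by rewrite -p'B' p'E mulmxDl jordan_last_row// addrA scaleNr addNr add0r.
  rewrite !rowE -pB -mulmxA (jordan_comm JB JB') mulmxA pB' mulmxDl.
  by rewrite (jordan_last_row _ JB) mulNr pB.
have B'E : B' = B - (s * b' * b) *: delta_mx ord0 ord_max.
  apply/matrixP => a c; rewrite (jordan_entry JB') !mxE (jordan_entry JB).
  have row_entry k : B' ord0 k =
      B ord0 k - (s * b' * b) * (k == ord_max)%:R.
    have := congr1 (fun r : 'rV[C]_n.+1 => r ord0 k) B'_row.
    by rewrite !mxE eqxx/= mulNr addrC.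
  have [ac|ca] := leqP a c; last first.
    have -> : (a == ord0) = false by apply: gtn_eqF; exact: leq_ltn_trans ca.
    by rewrite mulr0 subr0.
  rewrite row_entry; congr (_ - _ * (nat_of_bool _)%:R).
  have ca : (c - a < n.+1)%N by rewrite (leq_ltn_trans (leq_subr _ _)).
  rewrite -val_eqE /= inordK//; have [->|a0] := eqVneq a ord0.
    by rewrite subn0 -val_eqE.
  rewrite andFb; apply: ltn_eqF; have := ltn_ord c; rewrite ltnS.
  apply: leq_trans.
  rewrite ltn_subrL lt0n -[(a : nat) != 0%N]/(a != ord0) a0/=.
  by rewrite (leq_trans _ ac)// lt0n.
have q0 : (q *m B) ord0 ord0 = q ord0 ord0 * b := jordan_mul00 q JB.
rewrite q'E mulmxDl jordan_last_row// -/b' q0 {1}B'E mulmxBr -scalemxAr.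
have -> : q *m delta_mx (ord0 : 'I_n.+1) (ord_max : 'I_n.+1) =
    q ord0 ord0 *: (delta_mx 0 ord_max : 'rV_n.+1).
  by apply/rowP => k; rewrite mulmx_delta !mxE eqxx.
rewrite addrCA addrC; congr (_ + _); rewrite -scaleNr scalerA -scalerDl.
by congr (_ *: _); ring.
Qed.

End Jordan.

Section Theta.
Variable R : realType.
Local Notation C := R[i]^o.

(** The difference of the two powers is s X^n times a sum of products of j - 1 factors without
    constant term. In degree at most n only the constant term of that sum counts, and it vanishes
    unless j = 1. *)
Lemma coef_exp_addXn (q : {poly R[i]}) (s : R[i]) n a j :
  q`_0 = 0 -> (0 < n)%N -> (a <= n)%N -> (0 < j)%N ->
  ((q + s *: 'X^n) ^+ j)`_a = (q ^+ j)`_a + ((a == n) && (j == 1)%N)%:R * s.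
Proof.
move=> q0 n0 an j0.
rewrite -[(q + _) ^+ j](subrK (q ^+ j)) coefD addrC; congr (_ + _).
rewrite subrXX addrAC subrr add0r -scalerAl coefZ mulrC.
congr (_ * _); rewrite coefXnM.
move: an; rewrite leq_eqVlt => /orP[/eqP->|an]; last first.
  by rewrite an ltn_eqF.
rewrite ltnn subnn eqxx/= coef_sum.
have X0 : (q + s *: 'X^n)`_0 = 0.
  by rewrite coefD q0 coefZ coefXn eq_sym gtn_eqF// mulr0 addr0.
have coef0X (p : {poly R[i]}) k : p`_0 = 0 -> (p ^+ k)`_0 = (k == 0%N)%:R.
  by move=> p0; rewrite -horner_coef0 horner_exp horner_coef0 p0 expr0n.
under eq_bigr => k _.
  rewrite coef0M coef0X// coef0X//; over.
case: j j0 => // -[_|j _].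
  by rewrite big_ord1 mulr1.
rewrite big1// => k _; rewrite subn_eq0 /=.
have [jk|] := leqP j.+1 k; last by rewrite mul0r.
by rewrite mul1r; case: (k : nat) jk.
Qed.

(** Dividing by x_0 makes the series start at 1 on both sides, so that only the linear term of the
    logarithm, with coefficient 1, sees the perturbation. *)
Lemma theta_addXn (x : {poly C}) (t : C) n a :
  x`_0 != 0 -> (0 < a)%N -> (a <= n)%N ->
  theta (x + t *: 'X^n) a = theta x a + (a == n)%:R * (t / x`_0).
Proof.
move=> x0 a0 an.
have n0 : (0 < n)%N := leq_trans a0 an.
rewrite /theta !coef_sum.
have -> : (x + t *: 'X^n)`_0 = x`_0.
  by rewrite coefD coefZ coefXn eq_sym gtn_eqF// mulr0 addr0.
pose q := (x`_0)^-1 *: x - 1.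
have q0 : q`_0 = 0 by rewrite coefB coefZ mulVf// coef1 subrr.
have -> : (x`_0)^-1 *: (x + t *: 'X^n) - 1 = q + (t / x`_0) *: 'X^n.
  by rewrite scalerDr scalerA addrAC [t / _]mulrC.
rewrite -/q; under eq_big_nat => j /andP[j0 _].
  rewrite coefZ (coef_exp_addXn _ q0 n0 an j0) mulrDr; over.
rewrite big_split/=; congr (_ + _).
  by apply: eq_bigr => j _; rewrite coefZ.
rewrite big_ltn// big1_seq ?addr0; last first.
  move=> j /andP[_]; rewrite mem_index_iota => /andP[j1 _].
  by rewrite [j == 1%N]gtn_eqF// andbF mul0r mulr0.
by rewrite eqxx andbT expr2 mulN1r opprK divr1 mul1r.
Qed.

Lemma theta1 a : (0 < a)%N -> theta (1 : {poly C}) a = 0.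
Proof.
move=> a0; rewrite /theta coef1 eqxx invr1 scale1r subrr coef_sum big1_seq//.
move=> j /andP[_]; rewrite mem_index_iota => /andP[j0 _].
by rewrite expr0n gtn_eqF// scaler0 coef0.
Qed.

End Theta.

(** * The groups H_lambda *)

Section Blocks.
Variables (R : realType) (l : nat) (m : 'I_l -> nat).
Local Notation C := R[i]^o.
Local Notation N := (\sum_(k < l) (m k).+1)%N.
Local Notation block := (@submxrow C l (fun k => (m k).+1) _).
Local Notation ix k a := (@Defs.ix l m k a).

Lemma ix_eq k k' (a : 'I_(m k).+1) (b : 'I_(m k').+1) :
  (ix k a == ix k' b) = (k == k') && (a == b :> nat).
Proof. by rewrite -val_eqE; exact: tagnat.eq_Rank. Qed.

Lemma block_mul_diag r (z : 'M[C]_(r, N)) (B : forall k, 'M[C]_((m k).+1)) k :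
  block (z *m \mxdiag_(k < l) B k) k = block z k *m B k.
Proof. by rewrite -{1}(submxrowK z) mul_mxrow_mxdiag mxrowK. Qed.

Lemma hcoef_diag (B : forall k, 'M[C]_((m k).+1)) k a :
  @hcoef R l m (\mxdiag_(k < l) B k) k a = B k ord0 a.
Proof.
have := congr1 (fun A : 'M[C]_((m k).+1) => A ord0 a) (submxblock_diag B k).
by rewrite mxE.
Qed.

Lemma mul_diag (B B' : forall k, 'M[C]_((m k).+1)) :
  (\mxdiag_(k < l) B k) *m (\mxdiag_(k < l) B' k) =
  \mxdiag_(k < l) (B k *m B' k).
Proof.
rewrite [X in _ *m X]/mxdiag mul_mxdiag_mxblock; apply/eq_mxblock => i j.
by case: eqVneq => [->|_]; rewrite ?conform_mx_id// mulmx0.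
Qed.

Lemma invmx_diag (B : forall k, 'M[C]_((m k).+1)) :
  (forall k, B k \in unitmx) ->
  invmx (\mxdiag_(k < l) B k) = \mxdiag_(k < l) (invmx (B k)).
Proof.
move=> unitB.
have BV : (\mxdiag_(k < l) B k) *m (\mxdiag_(k < l) (invmx (B k))) = 1%:M.
  rewrite mul_diag; under eq_mxdiag do rewrite mulmxV//.
  exact: mxdiagZ.
have [uB _] := mulmx1_unit BV.
by rewrite -[RHS](mulKmx uB) BV mulmx1.
Qed.

Lemma block_delta (i k : 'I_l) (t : C) :
  block (t *: delta_mx 0 (ix i ord_max) : 'rV[C]_N) k =
  (t * (k == i)%:R) *: delta_mx 0 ord_max.
Proof.
apply/rowP => b; rewrite !mxE eqxx/= ix_eq -mulrA; congr (_ * _).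
have [ki|_] := eqVneq k i; last by rewrite mul0r.
by rewrite mul1r -val_eqE /= -ki.
Qed.

Lemma Xlam_row1 (x : 'M[C]_(2, N)) k :
  Xlam x -> block (row 1 x) k = delta_mx 0 ord0.
Proof.
case=> _ ->; apply/rowP => a; rewrite !mxE /=.
by rewrite tagnat.Rank2K.
Qed.

Section Point.
Variables (z : 'M[C]_(2, N)) (h : 'M[C]_N).
Hypotheses (h_lam : Hlam h) (x_lam : Xlam (z *m h)).

Lemma hcoef_invmx k a : @hcoef R l m (invmx h) k a = z 1 (ix k a).
Proof.
case: h_lam => B [JB hB]; have uB b : B b \in unitmx by case: (JB b).
rewrite hB (invmx_diag uB) hcoef_diag.
have := Xlam_row1 k x_lam; rewrite row_mul hB block_mul_diag.
move/(congr1 (fun r => r *m invmx (B k))); rewrite mulmxK// -rowE.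
move=> /(congr1 (fun r : 'rV[C]_(m k).+1 => r ord0 a)).
by rewrite !mxE.
Qed.

Lemma hcoef_ord0 k : @hcoef R l m h k ord0 * z 1 (ix k ord0) = 1.
Proof.
case: h_lam => B [JB hB]; rewrite hB hcoef_diag.
have := Xlam_row1 k x_lam; rewrite row_mul hB block_mul_diag.
move=> /(congr1 (fun r : 'rV[C]_(m k).+1 => r ord0 ord0)).
by rewrite (jordan_mul00 _ (JB k)) !mxE mulrC => ->.
Qed.

End Point.

Section Line.
Variables (z z' : 'M[C]_(2, N)) (h h' : 'M[C]_N).
Hypotheses (h_lam : Hlam h) (x_lam : Xlam (z *m h)).
Hypotheses (h'_lam : Hlam h') (x'_lam : Xlam (z' *m h')).

(** [jordan_line] is applied in each block to the rows 1 and 0 of z; in the blocks other than i both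
    perturbations are 0, and the row does not move. *)
Lemma slice_line i (s t : C) :
  z' = t *: delta_mx 0 (ix i ord_max) + s *: delta_mx 1 (ix i ord_max) + z ->
  row 0 (z' *m h') =
    ((t - s * (z *m h) 0 (ix i ord0)) * @hcoef R l m h' i ord0)
      *: delta_mx 0 (ix i ord_max)
    + row 0 (z *m h).
Proof.
move=> z'E; case: h_lam h'_lam x_lam x'_lam => B [JB hB] [B' [JB' h'B']] xl x'l.
apply/mxrowP => k; have := Xlam_row1 k xl; have := Xlam_row1 k x'l.
rewrite !row_mul {1}hB {1}h'B' !block_mul_diag => p'B' pB.
have row0E : row 0 z' = t *: delta_mx 0 (ix i ord_max) + row 0 z.
  by rewrite z'E; apply/rowP => c; rewrite !mxE/= mulr0 addr0.
have row1E : row 1 z' = s *: delta_mx 0 (ix i ord_max) + row 1 z.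
  by rewrite z'E; apply/rowP => c; rewrite !mxE/= mulr0 add0r.
have blockE r (u u' : 'rV[C]_N) :
    u' = r *: delta_mx 0 (ix i ord_max) + u ->
    block u' k = (r * (k == i)%:R) *: delta_mx 0 ord_max + block u k.
  by move=> ->; rewrite submxrowD block_delta.
rewrite {1}h'B' block_mul_diag.
rewrite (jordan_line (JB k) (JB' k) pB p'B'
  (blockE _ _ _ row1E) (blockE _ _ _ row0E)).
rewrite submxrowD [in X in _ = _ + X]hB block_mul_diag; congr (_ + _).
rewrite block_delta; congr (_ *: _).
have [->|] := eqVneq k i; last by rewrite !mulr0 !mul0r subrr mul0r.
rewrite !mulr1 h'B' hcoef_diag; congr ((_ - _ * _) * _).
by rewrite -block_mul_diag -hB -row_mul !mxE.
Qed.

(** The coefficients of h^-1 are the entries of row 1 of z, so that only [s] enters. *)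
Lemma hpoly_line i (s t : C) k :
  z' = t *: delta_mx 0 (ix i ord_max) + s *: delta_mx 1 (ix i ord_max) + z ->
  @hpoly R l m (invmx h') k =
  @hpoly R l m (invmx h) k + (s * (k == i)%:R) *: 'X^(m k).
Proof.
move=> z'E; apply/polyP => a.
rewrite coefD coefZ coefXn !coef_poly; case: ltnP => ak; last first.
  by rewrite gtn_eqF// mulr0 addr0.
rewrite (hcoef_invmx h'_lam x'_lam) (hcoef_invmx h_lam x_lam) z'E.
rewrite !mxE ix_eq /= inordK// mulr0 add0r [LHS]addrC; congr (_ + _).
rewrite -mulrA; congr (_ * _).
by have [->|_] := eqVneq k i; rewrite ?mul1r ?mul0r.
Qed.

End Line.

End Blocks.

(** * The induced operator *)

Section Character.
Variables (R : realType) (l : nat) (m : 'I_l -> nat).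
Local Notation C := R[i]^o.
Local Notation N := (\sum_(k < l) (m k).+1)%N.
Local Notation ix k a := (@Defs.ix l m k a).
Local Notation hc h k := (@hcoef R l m h k ord0).
Variable alpha : 'rV[C]_N.

Definition theta_part (h : 'M[C]_N) k : C :=
  \sum_(a < (m k).+1 | (0 < a)%N)
     alpha 0 (ix k a) * theta (@hpoly R l m h k) a.

Lemma chiE (g : 'M[C]_N * 'rV[C]_l) : chi alpha g =
  cexp (\sum_k (alpha 0 (ix k ord0) * g.2 0 k + theta_part g.1 k)).
Proof. by rewrite cexp_sum; apply: eq_bigr => k _; rewrite cexpD. Qed.

Lemma chi_neq0 (g : 'M[C]_N * 'rV[C]_l) : chi alpha g != 0.
Proof. by rewrite chiE cexp_neq0. Qed.

Lemma hpoly1 k : @hpoly R l m 1%:M k = 1.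
Proof.
apply/polyP => a; rewrite coef_poly coef1 /hcoef.
case: ltnP => am; last by rewrite gtn_eqF// (leq_trans _ am).
by rewrite mxE ix_eq eqxx inordK//= eq_sym.
Qed.

Lemma hcoef1 k : hc 1%:M k = 1.
Proof. by rewrite /hcoef mxE eqxx. Qed.

Lemma chi_Hinv_Hone : chi alpha (Hinv (@Hone R l m)) = 1.
Proof.
rewrite chiE /Hinv /Hone /= invmx1 oppr0 big1 ?cexp0// => k _.
rewrite mxE mulr0 add0r /theta_part hpoly1 big1// => a a0.
by rewrite theta1// mulr0.
Qed.

Lemma theta_part_addXn (h h' : 'M[C]_N) k (s : C) :
  @hpoly R l m h' k = @hpoly R l m h k + s *: 'X^(m k) ->
  (@hpoly R l m h k)`_0 != 0 ->
  theta_part h' k = theta_part h k + (0 < m k)%N%:R *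
    (alpha 0 (ix k ord_max) * (s / (@hpoly R l m h k)`_0)).
Proof.
move=> h'E p0; rewrite /theta_part h'E.
under eq_bigr => a a0.
  rewrite theta_addXn// -1?ltnS// mulrDr; over.
rewrite big_split/=; congr (_ + _).
have [mk|mk] := posnP (m k).
  rewrite mul0r big1// => a a0; have := ltn_ord a.
  by rewrite [X in (_ < X.+1)%N]mk ltnS leqn0 gtn_eqF.
rewrite mul1r (bigD1 ord_max)//= eqxx mul1r -[RHS]addr0; congr (_ + _).
apply: big1 => a /andP[_ am].
by rewrite -[a == m k :> nat]/(a == ord_max) (negPf am) mul0r mulr0.
Qed.

Section Line.
Variables (z z' : 'M[C]_(2, N)) (h h' : 'M[C]_N).
Hypotheses (h_lam : Hlam h) (x_lam : Xlam (z *m h)).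
Hypotheses (h'_lam : Hlam h') (x'_lam : Xlam (z' *m h')).
Variables (i : 'I_l) (s t : C).
Hypothesis z'E :
  z' = t *: delta_mx 0 (ix i ord_max) + s *: delta_mx 1 (ix i ord_max) + z.

Lemma theta_part_line k :
  theta_part (invmx h') k = theta_part (invmx h) k +
    (k == i)%:R * ((0 < m i)%N%:R * (alpha 0 (ix i ord_max) * (s * hc h i))).
Proof.
have z0 : z 1 (ix k ord0) != 0.
  apply/eqP => z0; have := hcoef_ord0 h_lam x_lam k.
  by rewrite z0 mulr0 => /eqP; rewrite eq_sym oner_eq0.
have p0E : (@hpoly R l m (invmx h) k)`_0 = z 1 (ix k ord0).
  rewrite coef_poly /= (_ : inord 0 = ord0) ?(hcoef_invmx h_lam x_lam)//.
  by apply/val_inj; rewrite /= inordK.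
rewrite (theta_part_addXn (hpoly_line h_lam x_lam h'_lam x'_lam k z'E)) p0E//.
congr (_ + _); have [ki|_] := eqVneq k i; last first.
  by rewrite mulr0 !mul0r !mulr0.
move: z0; rewrite ki => z0; rewrite mulr1 mul1r; congr (_ * (_ * _)).
by rewrite -[hc h i](mulfK z0) hcoef_ord0// mul1r.
Qed.

(** The logarithms [w] and [w'] are kept as free data; that they belong to one continuous branch is
    used only when differentiating. *)
Lemma chi_line (w w' : 'rV[C]_l) :
  chi alpha (Hinv (h', w')) = chi alpha (Hinv (h, w)) *
    cexp (\sum_k (- alpha 0 (ix k ord0)) * (w' 0 k - w 0 k) +
          (0 < m i)%N%:R * (alpha 0 (ix i ord_max) * (s * hc h i))).
Proof.
rewrite !chiE -cexpD; congr cexp; rewrite addrA -big_split/=.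
under eq_bigr do rewrite theta_part_line addrA.
rewrite big_split/=; congr (_ + _).
  by apply: eq_bigr => k _; rewrite !mxE; ring.
rewrite (bigD1 i)//= eqxx mul1r -[RHS]addr0; congr (_ + _).
by apply: big1 => k /negPf->; rewrite mul0r.
Qed.

End Line.
End Character.

(** * Derivatives of functions twisted by the character *)

Section Induced.
Variables (R : realType) (l : nat) (m : 'I_l -> nat).
Local Notation C := R[i]^o.
Local Notation N := (\sum_(k < l) (m k).+1)%N.
Local Notation ix k a := (@Defs.ix l m k a).
Local Notation hc h k := (@hcoef R l m h k ord0).
Variable alpha : 'rV[C]_N.
Variable U : set 'M[C]_(2, N).
Variable g : 'M[C]_(2, N) -> 'M[C]_N * 'rV[C]_l.
Hypotheses (U_open : open U) (g_cont : {within U, continuous g}).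
Hypothesis gU : forall z, U z -> Hcov (g z) /\ Xlam (z *m (g z).1).

Definition slice_row z := row 0 (z *m (g z).1).
Definition twist (v : 'rV[C]_N -> C) z : C :=
  chi alpha (Hinv (g z)) * v (slice_row z).
Local Notation y := slice_row.

Lemma row_neq0 z k : U z -> z 1 (ix k ord0) != 0.
Proof.
move=> /gU[[h_lam _] xl]; have := hcoef_ord0 h_lam xl k.
by move=> hz; apply/eqP => z0; move/eqP: hz; rewrite z0 mulr0 eq_sym oner_eq0.
Qed.

Lemma hcoef_row z k : U z -> hc (g z).1 k = (z 1 (ix k ord0))^-1.
Proof.
move=> Uz; apply: (mulIf (row_neq0 k Uz)); rewrite mulVf ?row_neq0//.
by have [[h_lam _] xl] := gU Uz; exact: hcoef_ord0.
Qed.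

Lemma U_line z v : U z -> \forall t \near (0 : C), U (t *: v + z).
Proof.
move=> Uz; apply: (@near_line R[i] 'M[C]_(2, N) U).
exact: open_nbhs_nbhs.
Qed.

Lemma log_cont z v k : U z -> forall e : C, 0 < e ->
  \forall t \near (0 : C), `|(g (t *: v + z)).2 0 k - (g z).2 0 k| <= e.
Proof.
move=> Uz e e0.
have g_z : g x @[x --> z] --> g z.
  move: g_cont; rewrite continuous_open_subspace// => gc.
  by apply: gc; rewrite inE.
have g2_z : (g x).2 @[x --> z] --> (g z).2.
  by apply: cvg_comp g_z _; exact: cvg_snd.
have g2_near : \forall x \near z, `|(g z).2 - (g x).2| <= e.
  by move/cvgrPdist_le: g2_z; apply.
have := @near_line R[i] 'M[C]_(2, N) _ z v g2_near.
apply: filterS => t; rewrite distrC; apply: le_trans.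
by have := mx_entry_le_norm ((g (t *: v + z)).2 - (g z).2) 0 k; rewrite !mxE.
Qed.

Lemma delta_split (r : 'I_2) i (t : C) (z : 'M[C]_(2, N)) :
  t *: delta_mx r (ix i ord_max) + z =
  (t * (r == 0)%:R) *: delta_mx 0 (ix i ord_max)
  + (t * (r == 1)%:R) *: delta_mx 1 (ix i ord_max) + z.
Proof.
congr (_ + _); rewrite -!scalerA -scalerDr; congr (_ *: _).
case: r => [[|[|//]] r2].
  rewrite (_ : Ordinal r2 = 0); last exact/val_inj.
  by rewrite eqxx scale1r scale0r addr0.
rewrite (_ : Ordinal r2 = 1); last exact/val_inj.
by rewrite eqxx scale1r scale0r add0r.
Qed.

(** The last column of a block is also its first only for a block of size one, the only case in
    which some h_0 can vary along the line. *)
Lemma row1_line (r : 'I_2) i k (t : C) (z : 'M[C]_(2, N)) :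
  (t *: delta_mx r (ix i ord_max) + z) 1 (ix k ord0) =
  z 1 (ix k ord0) + t * ((r == 1) && ((k == i) && (m i == 0%N)))%:R.
Proof.
by rewrite !mxE addrC [1 == r]eq_sym ix_eq /= [0%N == _]eq_sym.
Qed.

Lemma hcoef_line_const (r : 'I_2) i k z : i != k -> U z ->
  \forall t \near (0 : C),
    hc (g (t *: delta_mx r (ix i ord_max) + z)).1 k = hc (g z).1 k.
Proof.
move=> ik Uz; apply: filterS (U_line (delta_mx r (ix i ord_max)) Uz) => t Ut.
rewrite !hcoef_row// row1_line [k == i]eq_sym (negPf ik) andbF mulr0.
by rewrite addr0.
Qed.

(** The logarithm is a continuous lift through [cexp] of 1/(c + t b), where c = z^(k)_(1,0); hence
    its derivative is (- b/c^2) / (1/c) = - b/c. *)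
Lemma log_derive (r : 'I_2) i k z : U z ->
  is_derive (0 : C) 1
    (fun t : C => (g (t *: delta_mx r (ix i ord_max) + z)).2 0 k)
    (- ((r == 1) && ((k == i) && (m i == 0%N)))%:R * hc (g z).1 k).
Proof.
move=> Uz; set b : C := (_ && _)%:R.
set w := fun t : C => (g (t *: delta_mx r (ix i ord_max) + z)).2 0 k.
have w0 : w 0 = (g z).2 0 k by rewrite /w scale0r add0r.
have z0 := row_neq0 k Uz.
have Ew : is_derive (0 : C) 1 ((@cexp R : C -> C) \o w)
    (- b / z 1 (ix k ord0) ^+ 2).
  apply: (@is_derive_near_line _ C _ _
    (fun t : C => (z 1 (ix k ord0) + t * b)^-1)); last first.
    exact: (@is_derive_inv_affine R[i]).
  have := U_line (delta_mx r (ix i ord_max)) Uz; apply: filterS => t Ut /=.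
  rewrite addr0 [_%:A]mulr1 -row1_line -hcoef_row//.
  by have [[_ ->]] := gU Ut.
have cexp_w0 : cexp (w 0) = (z 1 (ix k ord0))^-1.
  by rewrite w0 -hcoef_row//; have [[_ ->]] := gU Uz.
have := @is_derive_lift R[i] (@cexp R) w _ _
  (cexp_neq0 _) (is_derive_cexp _) _ Ew.
have w_cont : forall e : C, 0 < e -> \forall t \near (0 : C), `|w t - w 0| <= e.
  by move=> e e0; rewrite w0; exact: log_cont.
move=> /(_ w_cont) dw; apply: is_derive_eq dw _.
rewrite cexp_w0 hcoef_row//; field.
exact: z0.
Qed.

(** Only the derivative of [v] in the moving coordinate is assumed, so that the lemma applies again
    to the first derivatives of v on the slice. A single formula in r serves both rows. *)
Lemma twist_derive (r : 'I_2) i (v : 'rV[C]_N -> C) (dv : C) z : U z ->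
  is_derive (y z) (delta_mx 0 (ix i ord_max)) v dv ->
  is_derive z (delta_mx r (ix i ord_max)) (twist v)
    (chi alpha (Hinv (g z)) * hc (g z).1 i *
     ((r == 1)%:R * (alpha 0 (ix i ord_max) * v (y z)) +
      ((r == 0)%:R - (r == 1)%:R * y z 0 (ix i ord0)) * dv)).
Proof.
move=> Uz dv_.
set D := delta_mx r (ix i ord_max).
pose w k (t : C) := (g (t *: D + z)).2 0 k.
pose c1 : C := (0 < m i)%N%:R * (alpha 0 (ix i ord_max) * hc (g z).1 i) *
  (r == 1)%:R.
pose psi (t : C) : C := \sum_k (- alpha 0 (ix k ord0)) * (w k t + - w k 0)
  + t * c1.
pose rho : C := (r == 0)%:R - (r == 1)%:R * y z 0 (ix i ord0).
(* The factor is h_0 at the moved point, written as an exponential to be differentiable; because of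
   the factor t, only its value at 0 enters the derivative. *)
pose phi (t : C) : C := t * (rho * cexp (w i t)).
have w0 k : w k 0 = (g z).2 0 k by rewrite /w scale0r add0r.
have line_eq : \forall t \near (0 : C), twist v (t *: D + z) =
    chi alpha (Hinv (g z)) * (cexp (psi t) *
      v (phi t *: delta_mx 0 (ix i ord_max) + y z)).
  have := U_line D Uz; apply: filterS => t Ut.
  have [[h_lam hw] xl] := gU Uz; have [[h'_lam h'w] x'l] := gU Ut.
  have zE := delta_split r i t z.
  rewrite /twist; have -> : y (t *: D + z) =
      phi t *: delta_mx 0 (ix i ord_max) + y z.
    rewrite /slice_row (slice_line h_lam xl h'_lam x'l zE); congr (_ *: _ + _).
    by rewrite -h'w /phi /rho /slice_row [row 0 _ 0 _]mxE /w; ring.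
  have chi_t : chi alpha (Hinv (g (t *: D + z))) =
      chi alpha (Hinv (g z)) * cexp (psi t).
    rewrite (chi_line alpha h_lam xl h'_lam x'l zE (g z).2 (g (t *: D + z)).2).
    apply: (congr1 (fun e => chi alpha (Hinv (g z)) * cexp e)).
    apply: (congr2 +%R); first by apply: eq_bigr => k _; rewrite w0.
    by rewrite /c1; ring.
  by rewrite chi_t; exact/esym/mulrA.
have psi0 : psi 0 = 0.
  rewrite /psi mul0r addr0; apply: big1 => k _.
  by rewrite subrr mulr0.
have phi0 : phi 0 = 0 by rewrite /phi mul0r.
have cexp_w0 : cexp (w i 0) = hc (g z).1 i.
  by rewrite w0; have [[_ ->]] := gU Uz.
have dw k := log_derive r i k Uz.
have dpsi : is_derive (0 : C) 1 psi
    ((r == 1)%:R * (alpha 0 (ix i ord_max) * hc (g z).1 i)).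
  have dsum := @is_derive_sumr R[i] C l _ 0 1 _ (fun k =>
    @is_derive_cmul R[i] C (- alpha 0 (ix k ord0)) _ 0 1 _
      (@is_derive_addr_cst R[i] C _ (- w k 0) 0 1 _ (dw k))).
  have dlin := @is_derive_id_mul R[i] (fun=> c1) 0 (is_derive_cst _ _ _).
  have := @is_derive_add R[i] C _ _ 0 1 _ _ dsum dlin.
  move=> dpsi; apply: is_derive_eq dpsi _.
  rewrite (bigD1 i)//= eqxx [X in _ + X + c1]big1 => [|k /negPf ki]; last first.
    by rewrite ki andbF oppr0 mul0r mulr0.
  (* Exactly one source contributes: the logarithm if n_i = 1, the theta part [c1] otherwise. In the
     first case the first and last columns coincide, so that the exponent is the same. *)
  rewrite /c1; have [mi|mi] := posnP (m i); last first.
    by rewrite andTb andbF mulr0n mulr1n; ring.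
  rewrite andbT; suff -> : ix i ord_max = ix i ord0.
    by rewrite mulr0n andbT; ring.
  by apply/eqP; rewrite ix_eq eqxx/= mi.
have dphi : is_derive (0 : C) 1 phi (rho * hc (g z).1 i).
  have dcexp := @is_derive_comp1 R[i] C C (w i) (@cexp R) 0 1 _ _ (dw i)
    (is_derive_cexp _).
  have := @is_derive_id_mul R[i] _ _ (@is_derive_cmul R[i] C rho _ 0 1 _ dcexp).
  by rewrite /= cexp_w0.
apply: is_derive_near_line line_eq _.
have dcexp : is_derive (0 : C) 1 ((@cexp R : C -> C) \o psi)
    ((r == 1)%:R * (alpha 0 (ix i ord_max) * hc (g z).1 i)).
  have := @is_derive_comp1 R[i] C C psi (@cexp R) 0 1 _ _
    dpsi (is_derive_cexp _).
  by rewrite psi0 cexp0 [_ *: _]mulr1.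
have dvphi := @is_derive_reparam R[i] 'rV[C]_N C v (y z) _ _ phi _
  phi0 dphi dv_.
have := @is_derive_cmul R[i] C (chi alpha (Hinv (g z))) _ _ _ _
  (@is_derive_mul R[i] C _ _ _ _ _ _ dcexp dvphi).
move=> dprod; apply: is_derive_eq dprod _.
rewrite /= psi0 cexp0 phi0 scale0r add0r -/rho.
have scaleE (c : C) : c *: dv = c * dv by [].
by rewrite scaleE; ring.
Qed.

End Induced.

Section MtildeInduced.
Variables (R : realType) (l : nat) (m : 'I_l -> nat).
Local Notation C := R[i]^o.
Local Notation N := (\sum_(k < l) (m k).+1)%N.
Local Notation ix k a := (@Defs.ix l m k a).
Local Notation hc h k := (@hcoef R l m h k ord0).

(** Both inner derivatives belong to the block j, so that both second derivatives contain the same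
    D^(i) D^(j) v, with coefficients - x^(j)_0 and - x^(i)_0; their difference is the leading
    coefficient of [Mtilde]. *)
Lemma box_induces_Mtilde (alpha : 'rV[C]_N) (i j : 'I_l) : i != j ->
  induces alpha (box (ord_max : 'I_(m i).+1) (ord_max : 'I_(m j).+1))
    (Mtilde alpha i j).
Proof.
move=> ij.
(* Each of the two derivatives contributes one factor h_0. *)
exists (fun _ g => chi alpha (Hinv g) * (hc g.1 i * hc g.1 j)); split.
- move=> z g [_ hw] _.
  by rewrite !mulf_neq0 ?chi_neq0// -hw cexp_neq0.
- by move=> x _; rewrite chi_Hinv_Hone !hcoef1 !mulr1.
move=> V v U g V_open _ v_hol U_open g_cont gUV z Uz.
have gU x : U x -> Hcov (g x) /\ Xlam (x *m (g x).1) by move=> /gUV[].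
have UV x : U x -> V (slice_row g x) by move=> /gUV[].
set y0 := row 0 (z *m (g z).1).
rewrite -/(twist alpha g v).
pose ei : 'rV[C]_N := delta_mx 0 (ix i ord_max).
pose ej : 'rV[C]_N := delta_mx 0 (ix j ord_max).
have dvV (e : 'rV[C]_N) y : V y -> is_derive y e v ('D_e v y).
  by move=> /v_hol/(holomorphic_deriveE e)[dv _]; exact: derivableP.
pose V1 y := alpha 0 (ix j ord_max) * v y - y 0 (ix j ord0) * 'D_ej v y.
have F1 x : U x -> 'D_(delta_mx 1 (ix j ord_max)) (twist alpha g v) x =
    hc (g x).1 j * twist alpha g V1 x.
  move=> Ux.
  have [_ ->] := twist_derive alpha U_open g_cont gU 1 Ux (dvV ej _ (UV _ Ux)).
  by rewrite eqxx /= mulr1n mulr0n /twist /V1; ring.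
have F0 x : U x -> 'D_(delta_mx 0 (ix j ord_max)) (twist alpha g v) x =
    hc (g x).1 j * twist alpha g ('D_ej v) x.
  move=> Ux.
  have [_ ->] := twist_derive alpha U_open g_cont gU 0 Ux (dvV ej _ (UV _ Ux)).
  by rewrite eqxx /= mulr1n mulr0n /twist; ring.
have Vy0 : V y0 := UV _ Uz.
have v_near : \forall y \near y0, holomorphic_at v y.
  by apply: filterS (open_nbhs_nbhs (conj V_open Vy0)) => y /v_hol.
have ji_max : ((0 : 'I_1), ix j ord_max) != (0, ix i ord_max).
  by rewrite xpair_eqE eqxx/= ix_eq eq_sym (negPf ij).
(* This provides the differentiability of D^(j) v along the coordinate of the block i. *)
have [c [dDj _]] := holomorphic_mixed ji_max v_near.
rewrite /= -/ej -/ei in dDj.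
have dV1 : is_derive y0 ei V1
    (alpha 0 (ix j ord_max) * 'D_ei v y0 - y0 0 (ix j ord0) * c).
  have d1 := @is_derive_cmul R[i] _ (alpha 0 (ix j ord_max)) _ _ _ _
    (dvV ei _ Vy0).
  have yj_const : \forall t \near (0 : C),
      (t *: ei + y0) 0 (ix j ord0) = y0 0 (ix j ord0).
    apply/nbhs_ballP; exists 1 => //= t _.
    by rewrite [LHS]mxE mxE mxE ix_eq eq_sym (negPf ij) /= mulr0 add0r.
  have d2 := @is_derive_mul_locally_constant R[i] _
    (fun y : 'rV[C]_N => y 0 (ix j ord0)) _ _ _ _ yj_const dDj.
  exact: (is_deriveB d1 d2).
have alg1 (A hi hj b e d : R[i]) :
    hj * (A * hi * (0 * b + (1 - 0 * e) * d)) = A * (hi * hj) * d by ring.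
have alg0 (A hi hj b e d : R[i]) :
    hj * (A * hi * (1 * b + (0 - 1 * e) * d)) = A * (hi * hj) * (b - e * d).
  by ring.
have alg (A xi xj ai aj di dj d : R[i]) :
    A * (aj * di - xj * d) - A * (ai * dj - xi * d) =
    A * ((xi - xj) * d + aj * di - ai * dj) by ring.
have U_near : \forall x \near z, U x := open_nbhs_nbhs (conj U_open Uz).
have dF1 : is_derive z (delta_mx 0 (ix i ord_max))
    ('D_(delta_mx 1 (ix j ord_max)) (twist alpha g v))
    (chi alpha (Hinv (g z)) * (hc (g z).1 i * hc (g z).1 j) *
     (alpha 0 (ix j ord_max) * 'D_ei v y0 - y0 0 (ix j ord0) * c)).
  apply: (@near_eq_is_derive _ _ _
    (fun x => hc (g x).1 j * twist alpha g V1 x)).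
    by apply: filterS U_near => x /F1.
  have dG := @is_derive_mul_locally_constant R[i] _
    (fun x => hc (g x).1 j) _ _ _ _
    (hcoef_line_const U_open gU 0 ij Uz)
    (twist_derive alpha U_open g_cont gU 0 Uz dV1).
  apply: is_derive_eq dG _; rewrite eqxx /= mulr1n mulr0n.
  exact: alg1.
have dF0 : is_derive z (delta_mx 1 (ix i ord_max))
    ('D_(delta_mx 0 (ix j ord_max)) (twist alpha g v))
    (chi alpha (Hinv (g z)) * (hc (g z).1 i * hc (g z).1 j) *
     (alpha 0 (ix i ord_max) * 'D_ej v y0 - y0 0 (ix i ord0) * c)).
  apply: (@near_eq_is_derive _ _ _
    (fun x => hc (g x).1 j * twist alpha g ('D_ej v) x)).
    by apply: filterS U_near => x /F0.
  have dG := @is_derive_mul_locally_constant R[i] _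
    (fun x => hc (g x).1 j) _ _ _ _
    (hcoef_line_const U_open gU 1 ij Uz)
    (twist_derive alpha U_open g_cont gU 1 Uz dDj).
  apply: is_derive_eq dG _; rewrite eqxx /= mulr1n mulr0n.
  exact: alg0.
have [_ E1] := dF1; have [_ E0] := dF0; have [_ E2] := dDj.
apply: etrans (congr2 (fun a b : C => a - b) E1 E0) _.
rewrite /Mtilde /dX -/ei -/ej E2 /=.
exact: alg.
Qed.

End MtildeInduced.

(** * Restriction of a function in S(alpha) to the slice *)

Section OneParameter.
Variables (R : realType) (l : nat) (m : 'I_l -> nat).
Local Notation C := R[i]^o.
Local Notation N := (\sum_(k < l) (m k).+1)%N.
Local Notation ix k a := (@Defs.ix l m k a).
Local Notation hc h k := (@hcoef R l m h k ord0).

Lemma jordan_add_corner n (a : C) : 1 + (n == 0%N)%:R * a != 0 ->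
  jordan (1%:M + a *: delta_mx ord0 ord_max : 'M[C]_n.+1).
Proof.
move=> a1; split.
  (* With E the corner matrix, E^2 = (n == 0) E, so that (1 + a E)(1 - b E) = 1 amounts to a = b (1
     + (n == 0) a). *)
  pose b := a / (1 + (n == 0%N)%:R * a).
  suff /mulmx1_unit[] : (1%:M + a *: delta_mx ord0 ord_max : 'M[C]_n.+1) *m
      (1%:M - b *: delta_mx ord0 ord_max) = 1%:M by [].
  rewrite mulmxDl mul1mx mulmxBr mulmx1 -scalemxAl -scalemxAr.
  rewrite mul_delta_mx_cond -val_eqE /= -scaler_nat !scalerA.
  rewrite addrAC -addrA -[RHS]addr0; congr (_ + _).
  rewrite -!scalerBl (_ : _ - _ - _ = 0) ?scale0r// /b.
  by field.
exists (fun k => (k == ord0)%:R + a * (k == ord_max)%:R).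
under eq_bigr do rewrite scalerDl.
rewrite big_split/= (bigD1 ord0)//= scale1r expr0.
rewrite big1 => [|k /negPf->]; last by rewrite scale0r.
rewrite addr0; congr (_ + _).
rewrite (bigD1 ord_max)//= eqxx mulr1 big1 => [|k /negPf->]; last first.
  by rewrite mulr0 scale0r.
rewrite addr0; congr (_ *: _); apply/matrixP => b c.
rewrite mxE shift_mxX; congr ((nat_of_bool _)%:R).
apply/andP/eqP => [[/eqP-> /eqP->]//|bc].
have := ltn_ord c; rewrite ltnS -bc /= -[X in (_ <= X)%N]add0n leq_add2r leqn0.
move=> b0; split; first by rewrite -val_eqE.
by rewrite -val_eqE /= -bc (eqP b0).
Qed.

Variable i : 'I_l.

Definition corner : 'M[C]_N := delta_mx (ix i ord0) (ix i ord_max).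

Lemma diag_corner (a : C) :
  1%:M + a *: corner = \mxdiag_(k < l)
    (1%:M + (a * (k == i)%:R) *: delta_mx ord0 ord_max : 'M[C]_((m k).+1)).
Proof.
rewrite mxdiagD (mxdiagZ (1 : C)); congr (_ + _).
apply/mxblockP => k k'; rewrite mxblockK; apply/matrixP => b c.
rewrite !mxE !ix_eq; have [kk'|kk'] := eqVneq k k'; last first.
  rewrite mxE; have [ki|] := eqVneq k i; last by rewrite mulr0.
  by rewrite -ki [k' == k]eq_sym (negPf kk') andbF mulr0.
case: k' / kk' c => c; rewrite conform_mx_id !mxE -mulrA; congr (_ * _).
have [ki|_] := eqVneq k i; last by rewrite mul0r.
by rewrite mul1r -!val_eqE /= -ki.
Qed.

(* Lambda^(n - 1) is the corner matrix; its square is 0 if n > 1, but it is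
   1 if n = 1.  Hence exp (t Lambda^(n - 1)) = 1 + kappa t Lambda^(n - 1). *)
Definition kappa (t : C) : C := if m i == 0%N then cexp t - 1 else t.

(** The one-parameter group exp (t Lambda^(n_i - 1)) of the block i, lifted to [Hcov]: the logarithm
    of h^(i)_0 is t if n_i = 1, and 0 otherwise. *)
Definition flow (t : C) : 'M[C]_N * 'rV[C]_l :=
  (1%:M + kappa t *: corner, ((m i == 0%N)%:R * t) *: delta_mx 0 i).

Lemma kappa0 : kappa 0 = 0.
Proof. by rewrite /kappa cexp0 subrr if_same. Qed.

Lemma is_derive_kappa : is_derive (0 : C) 1 kappa 1.
Proof.
have : kappa = fun t => if m i == 0%N then cexp t - 1 else t by [].
case: (m i == 0%N) => ->.
  rewrite -[X in is_derive _ _ _ X]cexp0.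
  exact: (@is_derive_addr_cst R[i] C _ (- 1) _ _ _ (is_derive_cexp 0)).
exact: (@is_derive_id R[i] C 0 1).
Qed.

Lemma flow0 : flow 0 = @Hone R l m.
Proof. by rewrite /flow kappa0 mulr0 !scale0r addr0. Qed.

Lemma hcoef_flow t k a : @hcoef R l m (flow t).1 k a =
  (a == ord0)%:R + kappa t * ((k == i)%:R * (a == ord_max)%:R).
Proof.
by rewrite /= diag_corner hcoef_diag !mxE !eqxx /= eq_sym mulrA.
Qed.

Lemma Hcov_flow t : Hcov (flow t).
Proof.
split.
  rewrite /= diag_corner; eexists; split; last by [].
  move=> k; apply: jordan_add_corner.
  have [->|_] := eqVneq k i; last by rewrite !mulr0 addr0 oner_eq0.
  rewrite mulr1 /kappa; case: (m i == 0%N); last first.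
    by rewrite mulr0n mul0r addr0 oner_eq0.
  by rewrite mulr1n mul1r addrC subrK cexp_neq0.
move=> k; rewrite hcoef_flow /= !mxE eqxx /=.
have [->|_] := eqVneq k i; last by rewrite mulr0 cexp0 mul0r mulr0 addr0.
rewrite mulr1 mul1r /kappa -val_eqE /= [0%N == _]eq_sym.
case: (m i == 0%N); last by rewrite !mulr0n mul0r mulr0 cexp0 addr0.
by rewrite !mulr1n !mul1r !mulr1 addrC subrK.
Qed.

Lemma hpoly_flow t k : @hpoly R l m (flow t).1 k =
  @hpoly R l m 1%:M k + (kappa t * (k == i)%:R) *: 'X^(m k).
Proof.
apply/polyP => a; rewrite hpoly1 coefD coef1 coefZ coefXn coef_poly hcoef_flow.
have [am|am] := ltnP a (m k).+1; last first.
  by rewrite !gtn_eqF ?mulr0 ?addr0//; exact: leq_trans am.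
by rewrite -!val_eqE /= inordK// mulrA.
Qed.

(** The exponent comes from the power of h_0 if n_i = 1 and from the last theta otherwise; both read
    alpha^(i)_(n_i - 1) t. *)
Lemma chi_flow (alpha : 'rV[C]_N) t :
  chi alpha (flow t) = cexp (alpha 0 (ix i ord_max) * t).
Proof.
have theta_flow k : theta_part alpha (flow t).1 k =
    (0 < m k)%N%:R * (alpha 0 (ix k ord_max) * (kappa t * (k == i)%:R)).
  rewrite (theta_part_addXn alpha (hpoly_flow t k)) hpoly1 coef1 ?oner_neq0//.
  rewrite {1}/theta_part hpoly1 big1 => [|a a0]; last by rewrite theta1// mulr0.
  by rewrite add0r divr1.
rewrite chiE; congr cexp; rewrite (bigD1 i)// -[RHS]addr0.
congr (_ + _); last first.
  apply: big1 => k /negPf ki; rewrite theta_flow !mxE ki andbF.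
  by rewrite mulr0n !mulr0 addr0.
rewrite theta_flow !mxE !eqxx /kappa.
have [mi|mi] := posnP (m i).
  have -> : ix i ord0 = ix i ord_max by apply/eqP; rewrite ix_eq eqxx /= mi.
  by rewrite andbT !mulr1n mulr0n; ring.
by rewrite andbT !mulr1n mulr0n; ring.
Qed.

Lemma mul_flow (z : 'M[C]_(2, N)) t : z *m (flow t).1 =
  kappa t *: (z 0 (ix i ord0) *: delta_mx 0 (ix i ord_max)
              + z 1 (ix i ord0) *: delta_mx 1 (ix i ord_max)) + z.
Proof.
rewrite /= mulmxDr mulmx1 -scalemxAr addrC.
apply: (congr1 (fun A : 'M[C]_(2, N) => kappa t *: A + z)).
apply/matrixP => r c; rewrite mulmx_delta !mxE.
case: r => [[|[|//]] r2].
  rewrite (_ : Ordinal r2 = 0); last exact/val_inj.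
  by rewrite eqxx /= mulr0 addr0.
rewrite (_ : Ordinal r2 = 1); last exact/val_inj.
by rewrite eqxx /= mulr0 add0r.
Qed.

End OneParameter.

Lemma cvg_pair_nbhs (T U V : topologicalType) (f : T -> U) (g : T -> V) x a b :
  f y @[y --> (x : T)] --> (a : U) -> g y @[y --> x] --> (b : V) ->
  (f y, g y) @[y --> x] --> (a, b).
Proof.
by move=> fa gb; exact: (@cvg_pair _ _ _ (nbhs x) (nbhs a) (nbhs b)).
Qed.

Lemma sum_delta_pair (K : pzRingType) n (a b : K) c (G : 'I_2 * 'I_n -> K) :
  \sum_e (a *: delta_mx 0 c + b *: delta_mx 1 c : 'M[K]_(2, n)) e.1 e.2 * G e =
  a * G (0, c) + b * G (1, c).
Proof.
rewrite (bigD1 (0, c))//= (bigD1 (1, c))//= big1 => [|[r d]].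
  by rewrite !mxE !eqxx /= !mulr0 !mulr1 add0r !addr0.
rewrite !xpair_eqE !mxE /= => /andP[/negPf-> /negPf->].
by rewrite !mulr0 addr0 mul0r.
Qed.

(** * Branches on a covering domain and the Euler equation *)

Section Covering.
Variables (R : realType) (l : nat) (m : 'I_l -> nat).
Local Notation C := R[i]^o.
Local Notation N := (\sum_(k < l) (m k).+1)%N.
Local Notation ix k a := (@Defs.ix l m k a).
Variable W : mvdomain R m.

Lemma mv_proj_open (A : set W) : open A -> open ((@mv_proj _ _ _ W) @` A).
Proof. by case: W A. Qed.

Lemma mv_proj_inj (w : W) :
  exists A : set W, [/\ open A, A w & {in A &, injective (@mv_proj _ _ _ W)}].
Proof.
have [A + A_inj] : exists2 A : set W, nbhs w A &
    {in A &, injective (@mv_proj _ _ _ W)} by case: W w.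
rewrite nbhsE => -[B [B_open Bw] BA]; exists B; split=> // w1 w2.
by rewrite !inE => /BA Aw1 /BA Aw2; apply: A_inj; rewrite inE.
Qed.

Lemma mv_proj_act (w : W) g : Hcov g -> mv_proj (mv_act w g) = mv_proj w *m g.1.
Proof.
by case: W w => ? ? ? ? ? ? ? proj_act ? ? ? w /=; exact: (proj_act w g).
Qed.

Lemma mv_act1 (w : W) : mv_act w (@Hone R l m) = w.
Proof. by case: W w. Qed.

Lemma mv_act_cont : {within
  [set q : W * ('M[C]_N * 'rV[C]_l) | Hcov q.2],
  continuous (fun q => mv_act q.1 q.2)}.
Proof. by case: W. Qed.

(** Near w, [s z] is the only point above z in a set A where the projection is injective. Since the
    projection is open, images of small open parts of A are neighbourhoods, which makes s continuous
    at nearby points too. *)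
Lemma local_section_near (w : W) s : local_section w s ->
  \forall z \near mv_proj w, local_section (s z) s /\ mv_proj (s z) = z.
Proof.
case=> sw s_cont s_proj; have [A [A_open Aw A_inj]] := mv_proj_inj w.
have : \forall z \near mv_proj w, A (s z) /\ mv_proj (s z) = z.
  near=> z; split; near: z => //.
  by apply: s_cont; rewrite sw; exact: open_nbhs_nbhs.
move=> /near_join near_good; apply: filterS near_good => z z_good.
have [Asz sz] := nbhs_singleton z_good.
split; last exact: sz.
split; [by rewrite sz | rewrite sz |].
  2: by rewrite sz; apply: filterS z_good => ? [].
move=> G; rewrite /= nbhsE => -[B [B_open Bsz] BG].
have BA_open : open ((@mv_proj _ _ _ W) @` (B `&` A)).
  by apply: mv_proj_open; exact: openI.
have BA_z : nbhs z ((@mv_proj _ _ _ W) @` (B `&` A)).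
  by apply: open_nbhs_nbhs; split=> //; exists (s z).
rewrite nbhs_simpl /=; near=> z'.
have [w' [Bw' Aw'] w'z'] : ((@mv_proj _ _ _ W) @` (B `&` A)) z' by near: z'.
have [Asz' sz'] : A (s z') /\ mv_proj (s z') = z' by near: z'.
apply: BG; rewrite (_ : s z' = w')//; apply: A_inj; rewrite ?inE//.
by rewrite sz' w'z'.
Unshelve. all: by end_near. Qed.

Variables (alpha : 'rV[C]_N) (u : W -> C).
Hypothesis u_S : Salpha alpha u.

(** For small t, the branch at z h and the translate of w by the lift of h lie above the same point
    and in a common set where the projection is injective, so they coincide; equivariance then gives
    the factor. *)
Lemma Salpha_flow (w : W) s k : local_section w s ->
  \forall t \near (0 : C),
    u (s (mv_proj w *m (flow m k t).1)) =
    u w * cexp (alpha 0 (ix k ord_max) * t).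
Proof.
move=> w_s; have [sw s_cont s_proj] := w_s.
have [A [A_open Aw A_inj]] := mv_proj_inj w.
have A_nbhs : nbhs w A by exact: open_nbhs_nbhs.
have kappa_lip := is_derive_lipschitz (@is_derive_kappa R l m k).
have kappa_small : \forall t \near (0 : C), `|kappa m k t| <= 2 * `|t|.
  apply: filterS kappa_lip => t.
  by rewrite kappa0 subr0 addr0 [_%:A]mulr1 normr1.
have kappa_cvg : kappa m k t @[t --> (0 : C)] --> (0 : C).
  exact: (@near0_norm_le R[i] C _ 2 _ kappa_small).
have flow_cvg :
    (flow m k t : 'M[C]_N * 'rV[C]_l) @[t --> (0 : C)] --> @Hone R l m.
  apply: (@cvg_pair_nbhs C 'M[C]_N 'rV[C]_l
    (fun t => 1%:M + kappa m k t *: corner R m k)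
    (fun t => ((m k == 0%N)%:R * t) *: delta_mx 0 k) 0 1%:M 0).
    apply/(@cvgrPdist_le _ _ _ _ (nbhs_filter (0 : C))) => e e0.
    have corner_small : \forall t \near (0 : C),
        `|kappa m k t *: corner R m k| <= 2 * `|corner R m k| * `|t|.
      apply: filterS kappa_small => t kt.
      by rewrite normrZ mulrAC ler_wpM2r.
    have B0 : 0 <= 2 * `|corner R m k| :> R[i] by rewrite mulr_ge0.
    have := @near0_norm_small R[i] 'M[C]_N _ _ _ B0 e0 corner_small.
    apply: (@filterS _ (nbhs (0 : C))) => t.
    by rewrite opprD addrA subrr add0r normrN.
  apply/(@cvgrPdist_le _ _ _ _ (nbhs_filter (0 : C))) => e e0.
  pose b : C := (m k == 0%N)%:R.
  have log_small : \forall t \near (0 : C),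
      `|(b * t) *: delta_mx 0 k : 'rV[C]_l|
      <= `|b| * `|delta_mx 0 k : 'rV[C]_l| * `|t|.
    by apply/nbhs_ballP; exists 1 => //= t _; rewrite normrZ normrM mulrAC.
  have B0 : 0 <= `|b| * `|delta_mx 0 k : 'rV[C]_l| :> R[i] by rewrite mulr_ge0.
  have := @near0_norm_small R[i] 'rV[C]_l _ _ _ B0 e0 log_small.
  by apply: (@filterS _ (nbhs (0 : C))) => t; rewrite sub0r normrN.
(* Continuity of the action is available only within [Hcov], and the flow never leaves it. *)
have curve_A : \forall t \near (0 : C), A (mv_act w (flow m k t)).
  have Hone_cov : Hcov (@Hone R l m).
    by rewrite -(@flow0 R l m k); exact: Hcov_flow.
  have act_cvg :=
    (subspace_continuousP _ _).1 mv_act_cont (w, Hone R m) Hone_cov.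
  have pair_cvg : (w, flow m k t) @[t --> (0 : C)] --> (w, @Hone R l m).
    have w_cst : w @[t --> (0 : C)] --> w.
      move=> P /nbhs_singleton Pw.
      apply: (@filterS _ (nbhs (0 : C)) _ setT) => //.
      exact: (@filterT _ (nbhs (0 : C))).
    exact: (@cvg_pair_nbhs C W ('M[C]_N * 'rV[C]_l)%type (fun=> w) (flow m k)
      0 w (@Hone R l m) w_cst flow_cvg).
  have A_act : nbhs ((fun q : W * ('M[C]_N * 'rV[C]_l) => mv_act q.1 q.2)
      (w, @Hone R l m)) A by rewrite /= mv_act1.
  have := pair_cvg _ (act_cvg _ A_act).
  by apply: (@filterS _ (nbhs (0 : C))) => t; apply; exact: Hcov_flow.
have point_near (P : set 'M[C]_(2, N)) : (\forall z \near mv_proj w, P z) ->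
    \forall t \near (0 : C), P (mv_proj w *m (flow m k t).1).
  move=> P_near.
  have := kappa_cvg _ (@near_line R[i] 'M[C]_(2, N) P _
    (mv_proj w 0 (ix k ord0) *: delta_mx 0 (ix k ord_max)
     + mv_proj w 1 (ix k ord0) *: delta_mx 1 (ix k ord_max)) P_near).
  by apply: (@filterS _ (nbhs (0 : C))) => t; rewrite mul_flow.
have section_A : \forall z \near mv_proj w, A (s z).
  by apply: s_cont; rewrite sw.
have s_A := point_near _ section_A.
have s_p := point_near _ s_proj.
near=> t.
have -> : s (mv_proj w *m (flow m k t).1) = mv_act w (flow m k t).
  apply: A_inj; rewrite ?inE; [by near: t|by near: t|].
  rewrite mv_proj_act; last exact: Hcov_flow.
  by near: t.
have [_ ->] := u_S; last exact: Hcov_flow.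
by rewrite chi_flow.
Unshelve. all: by end_near. Qed.

(** The derivative of [Salpha_flow] at t = 0; [kappa] has derivative 1 there, so that the velocity
    is the same for all block sizes. *)
Lemma Salpha_euler (w : W) s k : local_section w s ->
  let F := u \o s in let z := mv_proj w in
  z 0 (ix k ord0) * dZ 0 (ord_max : 'I_(m k).+1) F z
  + z 1 (ix k ord0) * dZ 1 (ord_max : 'I_(m k).+1) F z
  = alpha 0 (ix k ord_max) * F z.
Proof.
move=> w_s F z; have [sw _ _] := w_s.
have [/(_ w s w_s)[F_hol _] _] := u_S.
pose d := z 0 (ix k ord0) *: delta_mx 0 (ix k ord_max)
          + z 1 (ix k ord0) *: delta_mx 1 (ix k ord_max) : 'M[C]_(2, N).
have dF := holomorphic_deriveE d F_hol; rewrite -/F -/z in dF.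
have F_line := @is_derive_reparam R[i] _ _ _ _ _ _ (kappa m k) _
  (@kappa0 R l m k) (@is_derive_kappa R l m k) dF.
have F_exp : is_derive (0 : C) 1 (fun t => F (kappa m k t *: d + z))
    (F z * alpha 0 (ix k ord_max)).
  apply: (@is_derive_near_line R[i] C C _
    (fun t : C => F z * cexp (alpha 0 (ix k ord_max) * t))).
    apply: filterS (Salpha_flow k w_s) => t.
    by rewrite mul_flow [_%:A]mulr1 addr0 -/d -/z /F /= sw => ->.
  apply: is_derive_cmul.
  have dlin := @is_derive_cmul R[i] C (alpha 0 (ix k ord_max)) _ 0 1 _
    (@is_derive_id R[i] C 0 1).
  have := @is_derive_comp1 R[i] C C _ (@cexp R) 0 1 _ _ dlin (is_derive_cexp _).
  by rewrite mulr0 cexp0 mulr1 [_ *: _]mulr1.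
have [_ E1] := F_line; have [_ E2] := F_exp.
rewrite scale1r /d sum_delta_pair in E1.
by rewrite [RHS]mulrC; exact: etrans (esym E1) E2.
Qed.

End Covering.

(** * The differential equation on the slice *)

Section Restriction.
Variables (R : realType) (l : nat) (m : 'I_l -> nat).
Local Notation C := R[i]^o.
Local Notation N := (\sum_(k < l) (m k).+1)%N.
Local Notation ix k a := (@Defs.ix l m k a).

Lemma slice_line_shift (y : 'rV[C]_N) c (t : C) :
  slice (t *: delta_mx 0 c + y) = t *: delta_mx 0 c + slice y.
Proof.
apply/matrixP => r d; rewrite !mxE /=.
by case: (r == 0) => //=; rewrite mulr0 add0r.
Qed.

(** Since [slice] is affine, the two difference quotients are the same function of t. The identity
    at every [y] allows rewriting the inner derivative under the outer one. *)
Lemma dX_slice k a (F : 'M[C]_(2, N) -> C) (y : 'rV[C]_N) :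
  @dX R l m k a (fun y' => F (slice y')) y = dZ 0 a F (slice y).
Proof.
apply: (congr1 (fun q : C -> C => lim (q t @[t --> (0 : C)^']))).
by apply/funext => t /=; rewrite slice_line_shift.
Qed.

Lemma Mtilde_slice alpha i j (F : 'M[C]_(2, N) -> C) (y : 'rV[C]_N) :
  Mtilde alpha i j (fun y' => F (slice y')) y =
  (slice y 0 (ix i ord0) - slice y 0 (ix j ord0)) *
    dZ 0 (ord_max : 'I_(m i).+1) (dZ 0 (ord_max : 'I_(m j).+1) F) (slice y)
  + alpha 0 (ix j ord_max) * dZ 0 (ord_max : 'I_(m i).+1) F (slice y)
  - alpha 0 (ix i ord_max) * dZ 0 (ord_max : 'I_(m j).+1) F (slice y).
Proof.
rewrite /Mtilde !dX_slice !mxE /=.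
have -> : dX (ord_max : 'I_(m j).+1) (fun y' => F (slice y')) =
    (fun y' => dZ 0 (ord_max : 'I_(m j).+1) F (slice y')).
  by apply/funext => y'; exact: dX_slice.
by rewrite dX_slice.
Qed.

Variables (W : mvdomain R m) (alpha : 'rV[C]_N) (u : W -> C).
Hypothesis u_S : Salpha alpha u.
Variables (w : W) (s : 'M[C]_(2, N) -> W).
Hypotheses (w_s : local_section w s) (x_lam : Xlam (mv_proj w)).

Let F := u \o s.
Let x := mv_proj w.

Lemma branch_holomorphic : \forall z \near x, holomorphic_at F z.
Proof.
apply: filterS (local_section_near w_s) => z [z_s zE].
by have [/(_ _ _ z_s)[+ _] _] := u_S; rewrite zE.
Qed.

Lemma branch_euler k : \forall z \near x,
  (z : 'M[C]_(2, N)) 0 (ix k ord0) * dZ 0 (ord_max : 'I_(m k).+1) F z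
  + z 1 (ix k ord0) * dZ 1 (ord_max : 'I_(m k).+1) F z
  = alpha 0 (ix k ord_max) * F z.
Proof.
apply: filterS (local_section_near w_s) => z [z_s zE].
by have := Salpha_euler u_S k z_s; rewrite /= zE.
Qed.

Lemma row1_x k : x 1 (ix k ord0) = 1.
Proof. by rewrite /x; case: x_lam => _ ->; rewrite !mxE /= tagnat.Rank2K. Qed.

(** On the whole line, the first column of the block j keeps its value, with second entry 1, so that
    the Euler equation of that block expresses its derivative in row 1 through [F] and the
    derivative in row 0; this is then differentiated. *)
Lemma euler_derive (i j : 'I_l) (c : C) : i != j ->
  is_derive x (delta_mx 0 (ix i ord_max)) (dZ 0 (ord_max : 'I_(m j).+1) F) c ->
  is_derive x (delta_mx 0 (ix i ord_max)) (dZ 1 (ord_max : 'I_(m j).+1) F)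
    (alpha 0 (ix j ord_max) * dZ 0 (ord_max : 'I_(m i).+1) F x
     - x 0 (ix j ord0) * c).
Proof.
move=> ij dFj; set D := delta_mx 0 (ix i ord_max).
have D_coord r (t : C) : (t *: D + x) r (ix j ord0) = x r (ix j ord0).
  by rewrite !mxE ix_eq eq_sym [j == i]eq_sym (negPf ij) andbF mulr0 add0r.
have F_x := nbhs_singleton branch_holomorphic.
have [dFi _] := holomorphic_deriveE D F_x.
have d1 := @is_derive_cmul R[i] _ (alpha 0 (ix j ord_max)) _ _ _ _
  (derivableP dFi).
have d2 := @is_derive_cmul R[i] _ (x 0 (ix j ord0)) _ _ _ _ dFj.
have /is_derive_lineP d12 := is_deriveB d1 d2.
apply: is_derive_near_line d12.
apply: filterS (@near_line R[i] 'M[C]_(2, N) _ x D (branch_euler j)) => t.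
rewrite !D_coord row1_x mul1r => Ft.
rewrite -[LHS](addKr
  (x 0 (ix j ord0) * dZ 0 (ord_max : 'I_(m j).+1) F (t *: D + x))).
by rewrite Ft addrC.
Qed.

Lemma Mtilde_restriction (i j : 'I_l) : i != j ->
  Mtilde alpha i j (fun y => u (s (slice y))) (row 0 (mv_proj w)) = 0.
Proof.
rewrite -/x => ij; have xE : slice (row 0 x) = x by case: x_lam => _ <-.
rewrite (Mtilde_slice _ _ _ F) xE.
have e_neq (r r' : 'I_2) : (r, ix j ord_max) != (r', ix i ord_max).
  by rewrite xpair_eqE ix_eq [j == i]eq_sym (negPf ij) andbF.
have [c [dij dji]] := holomorphic_mixed (e_neq 0 0) branch_holomorphic.
(* The Euler equation of the block i computes the derivative in row 0 of the block j of the
   derivative in row 1 of the block i, whereas [box] takes them in the other order: the common value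
   c' exchanges them. *)
have [c' [d01 d10]] := holomorphic_mixed (e_neq 0 1) branch_holomorphic.
rewrite /= in dij dji d01 d10.
have [_ E1] := euler_derive ij dij.
have ji : j != i by rewrite eq_sym.
have [_ E2] := euler_derive ji dji.
have [_ E3] := d10; have [_ E4] := d01; have [_ E5] := dij.
have [u_sol _] := u_S; have [_ box_s] := u_sol w s w_s.
have box0 := box_s i j ord_max ord_max; rewrite /box -/F -/x in box0.
have -> : dZ 0 (ord_max : 'I_(m i).+1) (dZ 0 (ord_max : 'I_(m j).+1) F) x = c.
  exact: E5.
have alg (xi xj ai aj di dj d : R[i]) :
   (xi - xj) * d + aj * di - ai * dj =
   (aj * di - xj * d) - (ai * dj - xi * d) by ring.
rewrite alg; apply: etrans box0; apply: (congr2 (fun p q : C => p - q)).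
  exact: esym E1.
have E3' : dZ 0 (ord_max : 'I_(m j).+1) (dZ 1 (ord_max : 'I_(m i).+1) F) x = c'.
  exact: E3.
have E4' : dZ 1 (ord_max : 'I_(m i).+1) (dZ 0 (ord_max : 'I_(m j).+1) F) x = c'.
  exact: E4.
rewrite E4' -E3'; exact: esym E2.
Qed.

End Restriction.

Theorem proposition6p4 (R : realType) (l : nat) (m : 'I_l -> nat)
    (lambda_partition : forall k k' : 'I_l, (k <= k')%N -> (m k' <= m k)%N)
    (N_gt2 : (2 < \sum_(k < l) (m k).+1)%N)
    (alpha : 'rV[R[i]^o]_(\sum_(k < l) (m k).+1))
    (alpha_adm : admissible alpha)
    (i j : 'I_l) (neq_ij : i != j) :
  induces alpha
    (box (ord_max : 'I_(m i).+1) (ord_max : 'I_(m j).+1)) (Mtilde alpha i j) /\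
  (forall (W : mvdomain R m) (u : W -> R[i]^o), Salpha alpha u ->
     forall (w : W) (s : 'M[R[i]^o]_(2, \sum_(k < l) (m k).+1) -> W),
       local_section w s -> Xlam (mv_proj w) ->
       Mtilde alpha i j (fun y => u (s (slice y))) (row 0 (mv_proj w)) = 0).
Proof.
split; first exact: box_induces_Mtilde.
move=> W u u_S w s w_s x_lam.
exact: (Mtilde_restriction u_S w_s x_lam neq_ij).
Qed.
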